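(* Let $\ell$ be any odd positive integer. Then \begin{align*} \sum_{n=0}^{\infty}\overline{S}_{3\ell}(3n)q^n&=\frac{f_2^4f_4f_3^6f_\ell^2f_{4\ell}}{f_1^8f_6f_{12}f_{2\ell}^3}-4q\frac{f_2^4f_3^3f_{12}^2f_\ell^2f_{4\ell}}{f_1^7f_4f_6f_{2\ell}^3},\\ \sum_{n=0}^{\infty}\overline{S}_{3\ell}(3n+1)q^n&=2\frac{f_2^3f_3^3f_6^2f_\ell^2f_{4\ell}}{f_1^7f_{2\ell}^3f_{12}}-8q\frac{f_2^3f_6^2f_{12}^2f_\ell^2f_{4\ell}}{f_1^6f_4f_{2\ell}^3},\\ \sum_{n=0}^{\infty}\overline{S}_{3\ell}(3n+2)q^n&=4\frac{f_2^2f_6^5f_\ell^2f_{4\ell}}{f_1^6f_{2\ell}^3f_{12}}-2\frac{f_2^5f_3^6f_{12}^2f_\ell^2f_{4\ell}}{f_1^8f_6^4f_4f_{2\ell}^3}. \end{align*}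
   Context: For $|q|<1$ and a positive integer $k$, write $f_k=\prod_{j\ge1}(1-q^{kj})$. For an odd integer $t\ge3$, the number $\overline{S}_t(n)$ of $t$-Schur overpartitions of $n$ is defined by the generating function $\sum_{n\ge0}\overline{S}_t(n)q^n=\prod_{n\ge1}\frac{(1+q^{2n-1})(1-q^{t(2n-1)})}{(1+q^{t(2n-1)})(1-q^{2n-1})}=\frac{f_2^3f_t^2f_{4t}}{f_1^2f_4f_{2t}^3}$.
   Formalization: In the first identity the factor f_4 in the numerator of the first term is removed (f_2^4 f_3^6 f_ℓ^2 f_{4ℓ} instead of f_2^4 f_4 f_3^6 f_ℓ^2 f_{4ℓ}); as printed it fails at q^4 for every ℓ. The other two identities are unchanged. *)

(* Defs.v *)
From HB Require Import structures.
From mathcomp Require Import all_boot all_order all_algebra.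
From mathcomp Require Import complex.
From mathcomp Require Import all_classical all_reals all_analysis.
Set Implicit Arguments.
Unset Strict Implicit.
Unset Printing Implicit Defensive.
Import Order.TTheory GRing.Theory Num.Theory.
Import numFieldNormedType.Exports.
Local Open Scope classical_set_scope.
Local Open Scope ring_scope.

(* Stated over an arbitrary numFieldType K because that is where the library
   attaches the topology of the norm; instantiated at K := R[i] this is the
   usual topology of the complex plane. *)
Section QSeries.
Variable K : numFieldType.
Implicit Types (q v : K) (a u : nat -> K) (k t : nat).

Definition has_sum a v : Prop := series a @ \oo --> v.

Definition infprod u : K := limn (fun N => \prod_(1 <= j < N.+1) u j).

Definition eulerf q k : K := infprod (fun j => 1 - q ^+ (k * j)).

Definition schur_product t q : K :=
  infprod (fun n =>
    ((1 + q ^+ (2 * n - 1)%N) * (1 - q ^+ (t * (2 * n - 1))%N))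
    / ((1 + q ^+ (t * (2 * n - 1))%N) * (1 - q ^+ (2 * n - 1)%N))).

End QSeries.

(* Sbar n is the number of t-Schur overpartitions of n: the generating function
   determines Sbar uniquely. *)
Definition schur_overpartitions (R : realType) (t : nat) (Sbar : nat -> nat) : Prop :=
  forall q : R[i], `|q| < 1 ->
    has_sum (fun n => (Sbar n)%:R * q ^+ n) (schur_product t q).

(* Main.v *)
Require Import Defs.
From HB Require Import structures.
From mathcomp Require Import all_boot all_order all_algebra.
From mathcomp Require Import complex.
From mathcomp Require Import all_classical all_reals all_analysis.
From mathcomp Require Import ring lra zify.
Import Order.TTheory GRing.Theory Num.Theory.
Import numFieldNormedType.Exports.
Local Open Scope classical_set_scope.
Local Open Scope ring_scope.
Set Implicit Arguments.
Unset Strict Implicit.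
Unset Printing Implicit Defensive.

(* The generating function is phi(x^2) / phi(x) times a function of x^(3l),
   where phi(x) = f_1^2 / f_2 = sum_n (-1)^n x^(n^2).  Sorting the theta series
   by n modulo 3 and applying Jacobi's triple product to each part gives
   phi(x) = A - 2 x B, with A = phi(q^3) and B = f_1 f_6^2 / (f_2 f_3) taken at
   q = x^3.  If w is a primitive cube root of unity, the product of phi(x),
   phi(w x) and phi(w^2 x) is f_1^8 f_6 / (f_2^4 f_3^2) at q, so multiplying
   phi(x^2) / phi(x) by phi(w x) phi(w^2 x) makes the denominator a function of
   q and leaves a quadratic polynomial in x over functions of q.  Averaging the
   power series over x, w x, w^2 x then separates the three progressions when
   q <> 0, and q = 0 follows by continuity. *)

Import ComplexField ComplexField.Normc.

(** The hypothesis on [Sbar] only gives limits of partial sums, and nothing says beforehand that the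
    three sub-series converge. Identities are therefore proved on finite objects and then carried to
    the limit: a partial sum cut at 3N splits exactly into three, and each of the three is a fixed
    linear combination of sequences already known to converge. The triple product follows the same
    pattern. It is obtained from a finite identity weighted by Gaussian binomials, proved by
    induction, with explicit geometric error bounds for the passage to the limit; no Laurent
    expansion in an auxiliary variable and no rearrangement of infinite products occurs. The product
    over cube roots of unity and the two product sides needed for the theta series are likewise
    identities between truncated products, with truncations such as N, 2N, 3N, 6N chosen so that the
    factors match exactly. *)

(* The topology of the norm is attached to [K : numFieldType], and is not
   inferred on the bare type [R[i]]. *)
Definition tends (K : numFieldType) (u : nat -> K) (l : K) : Prop :=
  u @ \oo --> l.

(** * Convergence of complex series and products *)

Lemma norm_normc (R : realType) (z : R[i]) : `|z| = (normc z)%:C%C.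
Proof. by case: z. Qed.

Lemma normc_le (R : realType) (z : R[i]) (r : R) :
  (normc z <= r) = (`|z| <= r%:C%C).
Proof. by rewrite norm_normc lecR. Qed.

Lemma normc_ge0 (R : realType) (z : R[i]) : 0 <= normc z.
Proof. by case: z => a b; exact: sqrtr_ge0. Qed.

Lemma normcX (R : realType) (z : R[i]) n : normc (z ^+ n) = normc z ^+ n.
Proof.
elim: n => [|n IHn]; first by rewrite !expr0 normc1.
by rewrite !exprS normcM IHn.
Qed.

(** Bridge between the two norms: estimates are made with the real-valued [normc], whereas the
    topology is defined by the norm with values in [R[i]]. *)
Lemma cvg_normc (R : realType) (z : nat -> R[i]) (l : R[i]) (e : nat -> R) :
  (forall n, normc (l - z n) <= e n) -> e @ \oo --> 0 -> tends z l.
Proof.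
move=> ze e0; rewrite /tends; apply/cvgrPdist_lt => eps eps0.
(* A positive element of [R[i]] has imaginary part 0, so the radius may be taken real. *)
have Ee : eps = (complex.Re eps)%:C%C.
  by case: eps eps0 => a b; rewrite ltcE /= => /andP[/eqP -> _].
rewrite Ee (_ : 0 = 0%:C%C) // ltcR in eps0.
rewrite Ee; move/cvgrPdist_lt : e0 => /(_ _ eps0).
apply: filterS => n; rewrite sub0r normrN norm_normc ltcR.
by apply: le_lt_trans; rewrite (le_trans (ze n))// ler_norm.
Qed.

Lemma cvg_Re_Im (R : realType) (z : nat -> R[i]) (a b : R) :
  (fun n => complex.Re (z n)) @ \oo --> a ->
  (fun n => complex.Im (z n)) @ \oo --> b ->
  tends z (a +i* b)%C.
Proof.
move=> ha hb; apply: (@cvg_normc _ _ _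
  (fun n => `|a - complex.Re (z n)| + `|b - complex.Im (z n)|)).
  move=> n; rewrite normc_le; case: (z n) => x y /=.
  have -> : (a +i* b)%C - (x +i* y)%C =
      (a - x)%:C%C + (b - y)%:C%C * 'i%C :> R[i].
    by apply/eqP; rewrite eq_complex /=; apply/andP; split; apply/eqP; ring.
  rewrite (le_trans (ler_normD _ _))// normrM !norm_normc /=.
  by rewrite !expr0n expr1n /= !addr0 add0r sqrtr1 mulr1 !sqrtr_sqr rmorphD.
rewrite -[X in _ --> X](addr0 0); apply: cvgD.
  by have := cvg_norm (cvgB (cvg_cst a) ha); rewrite subrr normr0; apply.
by have := cvg_norm (cvgB (cvg_cst b) hb); rewrite subrr normr0; apply.
Qed.

(** Real and imaginary parts are dominated by the same geometric series, so completeness is needed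
    over the reals only. *)
Lemma cvg_series_geometric (R : realType) (d : nat -> R[i]) (C r : R) :
  0 <= C -> 0 <= r < 1 -> (forall n, normc (d n) <= C * r ^+ n) ->
  exists v, has_sum d v.
Proof.
move=> C0 /andP[r0 r1] hd.
have geo (u : nat -> R) : (forall n, `|u n| <= normc (d n)) -> cvgn (series u).
  move=> hu; apply: normed_cvg.
  apply: (series_le_cvg (v_ := geometric C r)) => [n|n|n|].
  - exact: normr_ge0.
  - by rewrite /= mulr_ge0// exprn_ge0.
  - by rewrite /= (le_trans (hu n)).
  - by apply: is_cvg_geometric_series; rewrite ger0_norm.
have hRe : cvgn (series (fun n => complex.Re (d n))).
  by apply: geo => n; rewrite -lecR (le_trans (normc_ge_Re _))// norm_normc.
have hIm : cvgn (series (fun n => complex.Im (d n))).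
  apply: geo => n; case: (d n) => x y /=.
  by rewrite -sqrtr_sqr ler_wsqrtr// lerDr sqr_ge0.
eexists; apply: cvg_Re_Im.
- rewrite (_ : (fun n => _) = series (fun n => complex.Re (d n))); first exact: hRe.
  by apply/funext => n; rewrite /series /= raddf_sum.
- rewrite (_ : (fun n => _) = series (fun n => complex.Im (d n))); first exact: hIm.
  by apply/funext => n; rewrite /series /= raddf_sum.
Qed.

(** From |1 + c_j| <= 1 + C r^j <= exp (C r^j), the partial products stay below exp (C / (1 -
    r)). *)
Lemma normc_prod_bounded (R : realType) (c : nat -> R[i]) (C r : R) :
  0 <= C -> 0 <= r < 1 -> (forall n, normc (c n) <= C * r ^+ n) ->
  exists2 M, 0 <= M &
    forall N, normc (\prod_(1 <= j < N.+1) (1 + c j)) <= M.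
Proof.
move=> C0 /andP[r0 r1] hc.
exists (expR (C / (1 - r))); first exact: expR_ge0.
have r1' : 0 < 1 - r by rewrite subr_gt0.
have bnd N : normc (\prod_(1 <= j < N.+1) (1 + c j)) <=
    expR (\sum_(1 <= j < N.+1) C * r ^+ j).
  elim: N => [|N IHN].
    by rewrite !big_geq // expR0 normc1.
  rewrite !(big_nat_recr N.+1) //= expRD normcM.
  apply: ler_pM; rewrite ?normc_ge0 //.
  apply: (le_trans (le_normcD _ _)).
  rewrite normc1 (le_trans _ (expR_ge1Dx _))//.
  by rewrite lerD2l hc.
move=> N; apply: (le_trans (bnd N)); rewrite ler_expR -big_distrr /=.
apply: ler_wpM2l => //.
have tel : (\sum_(1 <= j < N.+1) r ^+ j) * (1 - r) = r - r ^+ N.+1.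
  elim: N {bnd} => [|N IHN]; first by rewrite big_geq // mul0r expr1 subrr.
  by rewrite big_nat_recr //= mulrDl IHN !exprS; ring.
rewrite -[leLHS](mulfK (lt0r_neq0 r1')) tel ler_pdivrMr // mulVf ?lt0r_neq0 //.
have : 0 <= r ^+ N.+1 by rewrite exprn_ge0.
by lra.
Qed.

(** Consecutive partial products differ by P_n c_(n+1). As the P_n are bounded, these increments
    form a geometrically dominated series. *)
Lemma is_cvg_prod (R : realType) (c : nat -> R[i]) (C r : R) :
  0 <= C -> 0 <= r < 1 -> (forall n, normc (c n) <= C * r ^+ n) ->
  exists v, tends (fun N => \prod_(1 <= j < N.+1) (1 + c j)) v.
Proof.
move=> C0 r01 hc; have [M M0 hM] := normc_prod_bounded C0 r01 hc.
have [r0 r1] := andP r01.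
pose P N := \prod_(1 <= j < N.+1) (1 + c j).
have -> : (fun N => P N) = (fun N => 1 + series (fun n => P n * c n.+1) N).
  apply/funext => N; rewrite /series /=; elim: N => [|N IHN].
    by rewrite /P !big_geq // addr0.
  rewrite big_nat_recr //= addrA -IHN {1}/P big_nat_recr //= -/(P N).
  by rewrite mulrDr mulr1.
have [||n|v hv] := @cvg_series_geometric R (fun n => P n * c n.+1) (M * C) r.
- exact: mulr_ge0.
- exact: r01.
- rewrite normcM -mulrA; apply: ler_pM; rewrite ?normc_ge0 ?hM //.
  apply: (le_trans (hc _)); apply: ler_wpM2l => //.
  by rewrite exprS ler_piMl ?exprn_ge0 // ltW.
by exists (1 + v); apply: cvgD; [exact: cvg_cst | exact: hv].
Qed.

Section Tends.
Variable K : numFieldType.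
Implicit Types (u v : nat -> K) (a b : K).

Lemma tends_cst a : tends (fun=> a) a. Proof. exact: cvg_cst. Qed.

Lemma tendsD u v a b :
  tends u a -> tends v b -> tends (fun n => u n + v n) (a + b).
Proof. by move=> hu hv; exact: cvgD hu hv. Qed.

Lemma tendsB u v a b :
  tends u a -> tends v b -> tends (fun n => u n - v n) (a - b).
Proof. by move=> hu hv; exact: cvgB hu hv. Qed.

Lemma tendsM u v a b :
  tends u a -> tends v b -> tends (fun n => u n * v n) (a * b).
Proof. by move=> hu hv; exact: cvgM hu hv. Qed.

Lemma tendsX u a k : tends u a -> tends (fun n => u n ^+ k) (a ^+ k).
Proof.
move=> hu; elim: k => [|k IHk]; first exact: tends_cst.
by rewrite exprS; under eq_fun do rewrite exprS; exact: tendsM.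
Qed.

Lemma tendsV u a : a != 0 -> tends u a -> tends (fun n => (u n)^-1) a^-1.
Proof. by move=> a0 hu; exact: cvgV a0 hu. Qed.

Lemma tends_unique u a b : tends u a -> tends u b -> a = b.
Proof. by move=> ha hb; apply: (cvg_unique _ ha hb). Qed.

Lemma tends_lim u a : tends u a -> limn u = a.
Proof. by move=> ha; apply: cvg_lim. Qed.

Lemma tends_eq u v a : u =1 v -> tends u a -> tends v a.
Proof. by move=> /funext ->. Qed.

Lemma tends_subseq u a k d : (0 < k)%N -> tends u a ->
  tends (fun n => u (k * n + d)%N) a.
Proof.
move=> k0 hu; apply: (cvg_comp (fun n => (k * n + d)%N) u _ hu).
move=> S [N _ hS]; exists N => // n /= hn; apply: hS => /=.
by rewrite (leq_trans hn)// (leq_trans _ (leq_addr _ _))// leq_pmull.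
Qed.

Definition poch (y : K) N := \prod_(1 <= j < N.+1) (1 - y ^+ j).

Lemma poch0 y : poch y 0 = 1. Proof. by rewrite /poch big_geq. Qed.

Lemma pochS y N : poch y N.+1 = poch y N * (1 - y ^+ N.+1).
Proof. by rewrite /poch big_nat_recr. Qed.

Lemma sub1X_neq0 (y : K) n : `|y| < 1 -> (0 < n)%N -> 1 - y ^+ n != 0.
Proof.
move=> y1 n0; rewrite subr_eq0 eq_sym; apply/eqP => /(congr1 Num.norm) /eqP.
by rewrite normrX normr1 lt_eqF// exprn_ilt1// -lt0n.
Qed.

Lemma add1X_neq0 (y : K) n : `|y| < 1 -> (0 < n)%N -> 1 + y ^+ n != 0.
Proof.
move=> y1 n0; have : 1 - y ^+ (2 * n) != 0 by rewrite sub1X_neq0// muln_gt0.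
by apply: contraNneq => e; rewrite mulnC exprM -[1](expr1n _ 2) subr_sqr e mulr0.
Qed.

Lemma poch_neq0 (y : K) N : `|y| < 1 -> poch y N != 0.
Proof.
move=> y1; elim: N => [|N IHN]; first by rewrite poch0 oner_eq0.
by rewrite pochS mulf_neq0// sub1X_neq0.
Qed.

End Tends.

(** * Euler's product: nonvanishing and rate of convergence *)

Section Euler.
Variable R : realType.
Implicit Types (y q : R[i]).

Lemma normc_lt1 y : `|y| < 1 -> 0 <= normc y < 1.
Proof. by rewrite normc_ge0 /= norm_normc -[1]/(1%:C%C) ltcR. Qed.

Lemma normc_geo_bound y n : `|y| < 1 ->
  normc (- y ^+ n) <= 1 * normc y ^+ n.
Proof. by move=> y1; rewrite -normcX mul1r le_eqVlt normcN eqxx. Qed.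

Lemma normc_geoV_bound y n : `|y| < 1 -> (0 < n)%N ->
  normc (y ^+ n / (1 - y ^+ n)) <= (1 - normc y)^-1 * normc y ^+ n.
Proof.
move=> y1 n0; have /andP[r0 r1] := normc_lt1 y1.
rewrite normcM normcX normcV mulrC ler_wpM2r ?exprn_ge0// lef_pV2; last 2 first.
- rewrite posrE lt_neqAle normc_ge0 andbT eq_sym.
  by apply: contraNneq (sub1X_neq0 y1 n0) => /eq0_normc ->.
- by rewrite posrE subr_gt0.
have := le_normcD (1 - y ^+ n) (y ^+ n); rewrite subrK normc1 normcX.
have : normc y ^+ n <= normc y by rewrite -{2}[normc y]expr1 ler_wiXn2l // ltW.
lra.
Qed.

(** The reciprocal has again the shape of a product of 1 + c_j, so the same convergence lemmas apply
    to it. They bound c_n for every n; the test on [j] sets c_0 = 0, the index at which 1 - y^0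
    vanishes. *)
Lemma pochVE y N : `|y| < 1 ->
  (poch y N)^-1 = \prod_(1 <= j < N.+1)
    (1 + if (0 < j)%N then y ^+ j / (1 - y ^+ j) else 0).
Proof.
move=> y1; elim: N => [|N IHN]; first by rewrite poch0 big_geq// invr1.
rewrite pochS big_nat_recr//= -IHN.
have h1 := poch_neq0 N y1; have h2 := @sub1X_neq0 _ _ N.+1 y1 isT.
by field; apply/andP.
Qed.

Lemma normc_geoV_bound0 y n : `|y| < 1 ->
  normc (if (0 < n)%N then y ^+ n / (1 - y ^+ n) else 0)
  <= (1 - normc y)^-1 * normc y ^+ n.
Proof.
move=> y1; case: ifPn => n0; first exact: normc_geoV_bound.
have /andP[r0 r1] := normc_lt1 y1.
by rewrite normc0 mulr_ge0 ?exprn_ge0// invr_ge0 subr_ge0 ltW.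
Qed.

(** The limit is nonzero because the reciprocals converge too, and the product of the two limits is
    1. *)
Lemma poch_tends y : `|y| < 1 -> exists2 E, E != 0 & tends (poch y) E.
Proof.
move=> y1; have r01 := normc_lt1 y1; have /andP[r0 r1] := r01.
have [E hE] := is_cvg_prod (C := 1) ler01 r01 (fun n => normc_geo_bound n y1).
have C0 : 0 <= (1 - normc y)^-1 by rewrite invr_ge0 subr_ge0 ltW.
have [F hF] := is_cvg_prod C0 r01 (fun n => normc_geoV_bound0 n y1).
exists E; last exact: hE.
have h : tends (fun=> 1) (E * F).
  apply: tends_eq (tendsM hE hF) => n.
  by rewrite -pochVE// mulfV// poch_neq0.
apply/eqP => E0; have := tends_unique (@tends_cst R[i] 1) h.
by rewrite E0 mul0r => /eqP; rewrite oner_eq0.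
Qed.

Lemma poch_bounded y : `|y| < 1 -> exists2 M, 0 <= M &
  forall N, normc (poch y N) <= M /\ normc (poch y N)^-1 <= M.
Proof.
move=> y1; have r01 := normc_lt1 y1; have /andP[r0 r1] := r01.
have C0 : 0 <= (1 - normc y)^-1 by rewrite invr_ge0 subr_ge0 ltW.
have [M M0 hM] :=
  normc_prod_bounded (C := 1) ler01 r01 (fun n => normc_geo_bound n y1).
have [L L0 hL] := normc_prod_bounded C0 r01 (fun n => normc_geoV_bound0 n y1).
exists (M + L); first exact: addr_ge0.
move=> N; split; first by rewrite (le_trans (hM N))// lerDl.
by rewrite pochVE// (le_trans (hL N))// lerDr.
Qed.

Lemma poch_cauchy y : `|y| < 1 -> exists2 C, 0 <= C &
  forall m n, (m <= n)%N -> normc (poch y n - poch y m) <= C * normc y ^+ m.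
Proof.
move=> y1; have [M M0 hM] := poch_bounded y1.
have /andP[r0 r1] := normc_lt1 y1; have r1' : 0 < 1 - normc y by lra.
exists (M / (1 - normc y)); first by rewrite divr_ge0// ltW.
move=> m n /subnK <-; set k := (n - m)%N.
(* With r = |y|, keeping the difference of powers makes the induction close: passing from n to n + 1
   adds M / (1 - r) (r^n - r^(n+1)) = M r^n, which bounds the new increment. *)
suff : normc (poch y (k + m) - poch y m) <=
    M / (1 - normc y) * (normc y ^+ m - normc y ^+ (k + m)).
  move=> h; apply: (le_trans h); apply: ler_wpM2l.
    by rewrite divr_ge0// ltW.
  by rewrite gerBl exprn_ge0.
elim: k => [|k IHk]; first by rewrite add0n !subrr normc0 mulr0.
rewrite addSn pochS.
have -> : poch y (k + m) * (1 - y ^+ (k + m).+1) - poch y m =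
  (poch y (k + m) - poch y m) + - (poch y (k + m) * y ^+ (k + m).+1) by ring.
apply: (le_trans (le_normcD _ _)).
rewrite -[_ ^+ m](subrK (normc y ^+ (k + m))) -addrA mulrDr lerD//.
rewrite normcN normcM normcX exprS.
have -> : M / (1 - normc y) * (normc y ^+ (k + m) - normc y * normc y ^+ (k + m))
  = M * normc y ^+ (k + m) by field; rewrite lt0r_neq0.
apply: ler_pM; rewrite ?normc_ge0 ?mulr_ge0 ?exprn_ge0//.
  by case: (hM (k + m)%N).
by rewrite ler_piMl ?exprn_ge0// ltW.
Qed.

Lemma normX_lt1 q k : `|q| < 1 -> (0 < k)%N -> `|q ^+ k| < 1.
Proof. by move=> q1 k0; rewrite normrX exprn_ilt1// -lt0n. Qed.

Lemma eulerf_poch q k E : tends (poch (q ^+ k)) E -> eulerf q k = E.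
Proof.
move=> /tends_lim <-; rewrite /eulerf /infprod /poch.
by congr (lim _); under eq_fun do under eq_bigr do rewrite exprM.
Qed.

Lemma tends_eulerf q k : `|q| < 1 -> (0 < k)%N ->
  tends (poch (q ^+ k)) (eulerf q k).
Proof.
move=> q1 k0; have [E _ hE] := poch_tends (normX_lt1 q1 k0).
by rewrite (eulerf_poch hE).
Qed.

Lemma eulerf_neq0 q k : `|q| < 1 -> (0 < k)%N -> eulerf q k != 0.
Proof.
move=> q1 k0; have [E E0 hE] := poch_tends (normX_lt1 q1 k0).
by rewrite (eulerf_poch hE).
Qed.

Lemma eulerfX q k m : eulerf (q ^+ k) m = eulerf q (k * m).
Proof.
rewrite /eulerf /infprod; congr (lim _).
by under eq_fun do under eq_bigr do rewrite -exprM mulnA.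
Qed.

End Euler.

(** * Jacobi's triple product *)

Section FiniteTripleProduct.
Variables (K : numFieldType) (a b : K).
Let y := a * b.
Hypothesis y1 : `|y| < 1.

(** Equals c^(k(k+1)/2) d^(k(k-1)/2), the term of index k in Ramanujan's theta function f(c, d);
    exchanging c and d gives the term of index -k. The product form avoids halved exponents. *)
Definition theta_term (c d : K) k := \prod_(0 <= i < k) (c * (c * d) ^+ i).

Lemma theta_termS c d k :
  theta_term c d k.+1 = theta_term c d k * (c * (c * d) ^+ k).
Proof. by rewrite /theta_term big_nat_recr. Qed.

Lemma theta_term0 c d : theta_term c d 0 = 1.
Proof. by rewrite /theta_term big_geq. Qed.

(* The Gaussian binomial [2N choose N + k] in base z. *)
Definition central_qbin (z : K) N k :=
  if (k <= N)%N then poch z (2 * N) / (poch z (N - k) * poch z (N + k)) else 0.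

Local Notation W := (central_qbin y).

Lemma central_qbin_gt N k : (N < k)%N -> W N k = 0.
Proof. by move=> h; rewrite /central_qbin leqNgt h. Qed.

(** The q-Pascal rule applied twice, from 2N to 2N + 2. Its coefficients are those produced by
    multiplying the theta sum by (1 + a y^N)(1 + b y^N) = 1 + y^(2N+1) + (a + b) y^N. *)
Lemma central_qbinS N k :
  W N.+1 k.+1 = (1 + y ^+ (2 * N).+1) * W N k.+1 + y ^+ (N - k) * W N k
                + y ^+ (N + k.+2) * W N k.+2.
Proof.
have [ltNk|ltkN|<-] := ltngtP N k.
- by rewrite !central_qbin_gt ?mulr0 ?addr0 //; lia.
- pose d := (N - k.+1)%N; have Nd : N = (k.+1 + d)%N by rewrite /d; lia.
  (* One formula for two cases: if k + 2 = N + 1, then d = 0 and the factor 1 - y^d supplies the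
     value 0 taken out of range. *)
  have W2 : W N k.+2 =
      poch y (2 * N) * (1 - y ^+ d) / (poch y d * poch y (N + k).+2).
    rewrite /central_qbin; case: ifP => hk.
      have -> : d = (N - k.+2).+1 by rewrite /d; lia.
      rewrite pochS !addnS invfM [in RHS]invfM.
      have := sub1X_neq0 y1 (ltn0Sn (N - k.+2)%N).
      have := poch_neq0 (N - k.+2)%N y1; have := poch_neq0 (N + k).+2 y1.
      by move=> h1 h2 h3; field; rewrite h1 h2 h3.
    have -> : d = 0%N by rewrite /d; lia.
    by rewrite expr0 subrr mulr0 mul0r.
  rewrite W2 /central_qbin ltnS (ltnW ltkN) ltkN.
  have -> : (N.+1 - k.+1 = d.+1)%N by rewrite /d; lia.
  have -> : (N - k = d.+1)%N by rewrite /d; lia.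
  rewrite -/d !addSn !addnS mulnS !addSn add0n.
  rewrite !pochS.
  have -> : (2 * N = d + (N + k).+1)%N by rewrite /d; lia.
  have := sub1X_neq0 y1 (ltn0Sn d); have := sub1X_neq0 y1 (ltn0Sn (N + k)).
  have := sub1X_neq0 y1 (ltn0Sn (N + k).+1).
  have := poch_neq0 d y1; have := poch_neq0 (N + k)%N y1.
  rewrite !(exprS, exprD).
  move: (y ^+ d) (y ^+ N) (y ^+ k) (poch y d) (poch y (N + k)) => U V1 V2 p p'.
  move: (poch _ _) => P h1 h2 h3 h4 h5.
  by field; rewrite h1 h2 h3 h4 h5.
- rewrite (@central_qbin_gt N N.+1)// (@central_qbin_gt N N.+2)//.
  rewrite !mulr0 addr0 add0r subnn expr0 mul1r /central_qbin !leqnn !subnn.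
  rewrite poch0 !mul1r.
  by rewrite !addnn -!mul2n !mulfV// poch_neq0.
Qed.

(** The preceding recurrence at index 0; the symmetry between the indices 1 and -1 produces the
    factor 2. *)
Lemma central_qbinS0 N :
  W N.+1 0 = (1 + y ^+ (2 * N).+1) * W N 0 + 2 * y ^+ N.+1 * W N 1.
Proof.
have [->|N0] := posnP N.
  rewrite (@central_qbin_gt 0 1)// mulr0 addr0 /central_qbin /= subnn addn0 muln0.
  rewrite muln1 !subn0 !addn0 !pochS poch0 !expr1 !mul1r.
  have := sub1X_neq0 y1 (ltn0Sn 0); rewrite expr1 => h.
  by field.
rewrite /central_qbin N0 /= !subn0 !addn0 addn1 mulnS !addSn add0n.
have Np : N = N.-1.+1 by rewrite prednK.
rewrite subn1 [in X in _ = X]Np; move: (N.-1) Np => d ->.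
rewrite /= !pochS mul2n -addnn.
have := poch_neq0 d y1; have := sub1X_neq0 y1 (ltn0Sn d).
have := sub1X_neq0 y1 (ltn0Sn d.+1).
rewrite -addSnnS.
rewrite !(exprS, exprD).
move: (y ^+ d) (poch y d) (poch _ _) => U p P h1 h2 h3.
by field; rewrite h1 h2 h3.
Qed.

(** The part of the finite theta sum of positive index. The cutoff M is independent of N, so that an
    induction on N keeps the range fixed; weights beyond N vanish. *)
Definition half_theta c d N M :=
  \sum_(0 <= k < M) W N k.+1 * theta_term c d k.+1.

(** The new factors shift the index by one in both directions. The two corrections are the boundary
    terms at 0 and 1; adding both halves to [central_qbinS0], the terms in [W N 1] cancel and those
    in [W N 0] complete the factor. *)
Lemma half_thetaS c d N M : c * d = y -> (N < M)%N ->
  half_theta c d N.+1 M =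
    (1 + y ^+ (2 * N).+1 + c * y ^+ N + d * y ^+ N) * half_theta c d N M
    + c * y ^+ N * W N 0 - y ^+ N.+1 * W N 1.
Proof.
move=> cd NM; pose u k := W N k * theta_term c d k.
have shift v : \sum_(0 <= k < M) v k = \sum_(0 <= k < M) v k.+1 + v 0%N - v M :> K.
  by rewrite -[in RHS]addrA -opprB -telescope_sumr// sumrB opprB addrC subrK.
have uM k : (M <= k)%N -> u k = 0.
  by move=> Mk; rewrite /u central_qbin_gt ?mul0r// (leq_trans NM).
have E k : W N.+1 k.+1 * theta_term c d k.+1 =
    (1 + y ^+ (2 * N).+1) * u k.+1 + c * y ^+ N * u k + d * y ^+ N * u k.+2.
  have T1 : y ^+ (N - k) * W N k * theta_term c d k.+1 = c * y ^+ N * u k.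
    have [kN|Nk] := leqP k N; last first.
      by rewrite /u central_qbin_gt// !(mul0r, mulr0).
    have -> : y ^+ N = y ^+ (N - k) * y ^+ k by rewrite -exprD subnK.
    by rewrite /u theta_termS cd; ring.
  have T2 : y ^+ (N + k.+2) * W N k.+2 * theta_term c d k.+1 =
      d * y ^+ N * u k.+2.
    rewrite /u (theta_termS c d k.+1) cd.
    have -> : y ^+ (N + k.+2) = y ^+ N * y ^+ k.+1 * (c * d).
      by rewrite cd -exprD -exprSr addnS.
    by ring.
  by rewrite central_qbinS 2!mulrDl T1 T2 /u; ring.
rewrite /half_theta; under eq_bigr do rewrite E.
rewrite !big_split /= -!mulr_sumr (shift u) (uM M)// subr0.
have := shift (fun k => u k.+1); rewrite (uM M.+1)// subr0 => h.
have {h} -> : \sum_(0 <= k < M) u k.+2 = \sum_(0 <= k < M) u k.+1 - u 1%N.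
  by rewrite h addrK.
have -> : u 0%N = W N 0 by rewrite /u theta_term0 mulr1.
have -> : u 1%N = W N 1 * c.
  by rewrite /u theta_termS theta_term0 expr0 mul1r mulr1.
have -> : y ^+ N.+1 = y ^+ N * (c * d) by rewrite cd exprSr.
ring.
Qed.

Lemma finite_triple_product N M : (N <= M)%N ->
  W N 0 + half_theta a b N M + half_theta b a N M =
  \prod_(0 <= j < N) ((1 + a * y ^+ j) * (1 + b * y ^+ j)).
Proof.
elim: N => [|N IHN] NM.
  rewrite big_geq// /half_theta !big1 ?addr0; last 2 first.
  - by move=> k _; rewrite central_qbin_gt// mul0r.
  - by move=> k _; rewrite central_qbin_gt// mul0r.
  by rewrite /central_qbin /= subnn addn0 muln0 poch0 mulr1 divr1.
rewrite big_nat_recr//= -(IHN (ltnW NM)).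
rewrite central_qbinS0 (half_thetaS (erefl _) NM) (half_thetaS (mulrC b a) NM).
have -> : y ^+ (2 * N).+1 = a * y ^+ N * (b * y ^+ N).
  by rewrite exprS mulnC exprM /y; ring.
ring.
Qed.

End FiniteTripleProduct.

Lemma cvg_nat_geometric (R : realType) (r : R) : 0 <= r < 1 ->
  (fun n : nat => n.+1%:R * r ^+ n) @ \oo --> 0.
Proof.
(* Write r^n = s^n s^n. One factor absorbs n + 1, since (1 - s^(n+1)) / (1 - s) is a sum of n + 1
   powers that are all at least s^n; the other tends to 0. *)
move=> /andP[r0 r1]; pose s := Num.sqrt r.
have s0 : 0 <= s by exact: sqrtr_ge0.
have s1 : s < 1 by rewrite -[1]sqrtr1 ltr_sqrt.
have rs : r = s ^+ 2 by rewrite sqr_sqrtr.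
have bnd n : n.+1%:R * (1 - s) * s ^+ n <= 1 - s ^+ n.+1.
  elim: n => [|n IHn]; first by rewrite mul1r expr0 mulr1 expr1.
  have := ler_wpM2l s0 IHn.
  have : 0 <= (1 - s) * (1 - s * s ^+ n).
    rewrite mulr_ge0 ?subr_ge0 ?(ltW s1)// -exprS.
    by rewrite exprn_ile1// ltW.
  rewrite -[n.+2%:R]natr1 !exprS; move: (n.+1%:R) (s ^+ n) => m z.
  lra.
apply: (@squeeze_cvgr _ _ _ _ (fun=> 0) (fun n => (1 - s)^-1 * s ^+ n)).
- near=> n; rewrite mulr_ge0 ?exprn_ge0//= rs exprAC expr2 mulrA.
  rewrite ler_wpM2r ?exprn_ge0// -[_^-1]mul1r ler_pdivlMr ?subr_gt0// mulrAC.
  by rewrite (le_trans (bnd n))// gerBl exprn_ge0.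
- exact: cvg_cst.
- by apply: (@cvg_geometric R); rewrite ger0_norm.
Unshelve. all: by end_near.
Qed.

Section TripleProduct.
Variables (R : realType) (a b : R[i]).
Let y := a * b.
Hypotheses (a1 : `|a| <= 1) (b1 : `|b| <= 1) (y1 : `|y| < 1).

(** The sum of the terms of f(c, d) with index between -N and N. *)
Definition theta_partial (K : numFieldType) (c d : K) N :=
  1 + \sum_(0 <= k < N) (theta_term c d k.+1 + theta_term d c k.+1).

Lemma normc_theta_term (c d : R[i]) k : `|c| <= 1 -> `|c * d| < 1 ->
  normc (theta_term c d k.+1) <= normc (c * d) ^+ k.
Proof.
move=> c1 cd1; have /andP[r0 r1] := normc_lt1 cd1.
have c1' : normc c <= 1 by rewrite normc_le.
have t1 : forall m, normc (theta_term c d m) <= 1.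
  elim=> [|m IHm]; first by rewrite theta_term0 normc1.
  rewrite theta_termS !normcM normcX mulr_ile1 ?mulr_ge0 ?exprn_ge0 ?normc_ge0//.
  by rewrite mulr_ile1 ?exprn_ge0 ?normc_ge0// exprn_ile1// ltW.
rewrite theta_termS normcM (normcM c) normcX mulrA ler_piMl ?exprn_ge0 ?normc_ge0//.
by rewrite mulr_ile1 ?normc_ge0.
Qed.

(** The factor in front is the inverse of [central_qbin y N 0], so the normalised weight is (y)_N^2
    / ((y)_(N-k) (y)_(N+k)), where (y)_m is [poch y m]; [poch_cauchy] gives its distance to 1. The
    bound is weak for k near N, where the theta terms are small. *)
Lemma central_qbin_limit : exists2 C, 0 <= C & forall N k, (k <= N)%N ->
  normc (1 - poch y N ^+ 2 / poch y (2 * N) * central_qbin y N k)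
    <= C * normc y ^+ (N - k).
Proof.
have [M M0 hM] := poch_bounded y1; have [C C0 hC] := poch_cauchy y1.
exists (M ^+ 3 * C * 2); first by rewrite !mulr_ge0 ?exprn_ge0.
move=> N k kN; rewrite /central_qbin kN.
have h1 := poch_neq0 N y1; have h2 := poch_neq0 (2 * N) y1.
have h3 := poch_neq0 (N - k) y1; have h4 := poch_neq0 (N + k) y1.
have -> : 1 - poch y N ^+ 2 / poch y (2 * N) *
     (poch y (2 * N) / (poch y (N - k) * poch y (N + k))) =
  (poch y (N - k))^-1 * (poch y (N + k))^-1 *
   (poch y (N - k) * (poch y (N + k) - poch y N) +
    - (poch y N * (poch y N - poch y (N - k)))).
  by field; rewrite h2 h3 h4.
have [_ i1] := hM (N - k)%N; have [_ i2] := hM (N + k)%N.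
have [i3 _] := hM (N - k)%N; have [i4 _] := hM N.
have i5 := hC _ _ (leq_addr k N); have i6 := hC _ _ (leq_subr k N).
have /andP[r0 r1] := normc_lt1 y1.
have i7 : normc y ^+ N <= normc y ^+ (N - k).
  by rewrite ler_wiXn2l ?leq_subr// ltW.
rewrite normcM (normcM (poch y (N - k))^-1).
have -> : M ^+ 3 * C * 2 * normc y ^+ (N - k) =
  (M * M) * (M * (C * normc y ^+ (N - k)) + M * (C * normc y ^+ (N - k))) by ring.
apply: ler_pM; rewrite ?mulr_ge0 ?normc_ge0//.
  by apply: ler_pM; rewrite ?normc_ge0.
apply: (le_trans (le_normcD _ _)); rewrite normcN.
rewrite (normcM (poch y (N - k))) (normcM (poch y N)).
apply: lerD; apply: ler_pM; rewrite ?normc_ge0//.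
by apply: (le_trans i5); rewrite ler_wpM2l.
Qed.

Lemma jacobi_triple_product L :
  tends (fun N => \prod_(0 <= j < N) ((1 + a * y ^+ j) * (1 + b * y ^+ j))) L ->
  tends (theta_partial a b) (eulerf y 1 * L).
Proof.
move=> hL; have hE := tends_eulerf y1 (ltn0Sn 0); rewrite expr1 in hE.
set E := eulerf y 1 in hE *; have E0 : E != 0 by rewrite eulerf_neq0.
pose c N := poch y N ^+ 2 / poch y (2 * N).
have hc : tends c E.
  have -> : E = E ^+ 2 / E by field.
  have h2 : tends (fun N => poch y (2 * N)) E.
    by apply: tends_eq (tends_subseq 0 (ltn0Sn 1) hE) => n; rewrite addn0.
  exact: tendsM (tendsX (k := 2%N) hE) (tendsV E0 h2).
pose err N := \sum_(0 <= k < N) (1 - c N * central_qbin y N k.+1) *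
  (theta_term a b k.+1 + theta_term b a k.+1).
have thE N : theta_partial a b N =
    c N * (\prod_(0 <= j < N) ((1 + a * y ^+ j) * (1 + b * y ^+ j))) + err N.
  rewrite -(finite_triple_product y1 (leqnn N)) /half_theta !mulrDr.
  have -> : c N * central_qbin y N 0 = 1.
    rewrite /c /central_qbin /= subn0 addn0.
    have h1 := poch_neq0 N y1; have h2 := poch_neq0 (2 * N) y1.
    by field; rewrite h1 h2.
  rewrite /theta_partial -!addrA; congr (1 + _).
  rewrite !mulr_sumr /err -!big_split /=; apply: eq_bigr => k _.
  by ring.
(* With r = |y|, the weight in summand k is off by O(r^(n-k)) and the theta terms there are at most
   r^k. Each of the n + 1 summands of [err n.+1] is thus O(r^n), uniformly in k. *)
have herr : tends err 0.
  suff : tends (fun n => err n.+1) 0 by rewrite /tends cvg_shiftS.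
  have [C C0 hC] := central_qbin_limit.
  have r01 := normc_lt1 y1; have /andP[r0 r1] := r01.
  apply: (@cvg_normc _ _ _ (fun n => C * 2 * (n.+1%:R * normc y ^+ n))).
    move=> n; rewrite sub0r normcN /err.
    have sum_le m (F : nat -> R[i]) B : (forall k, (k < m)%N -> normc (F k) <= B) ->
        normc (\sum_(0 <= k < m) F k) <= m%:R * B.
      elim: m => [|m IHm] hF; first by rewrite big_geq// normc0 mul0r.
      rewrite big_nat_recr//= (le_trans (le_normcD _ _))//.
      rewrite -natr1 mulrDl mul1r lerD ?hF// IHm// => k km.
      by rewrite hF// ltnW.
    rewrite mulrCA; apply: sum_le => k kn; rewrite normcM.
    have -> : C * 2 * normc y ^+ n =
       (C * normc y ^+ (n.+1 - k.+1)) * (normc y ^+ k + normc y ^+ k).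
      by rewrite subSS -{1}(subnK (kn : (k <= n)%N)) exprD; ring.
    apply: ler_pM; rewrite ?normc_ge0 ?hC//.
    apply: (le_trans (le_normcD _ _)); apply: lerD; first exact: normc_theta_term.
    by rewrite /y mulrC normc_theta_term// mulrC.
  rewrite -[X in _ --> X](mulr0 (C * 2)); apply: cvgM; first exact: cvg_cst.
  exact: cvg_nat_geometric.
have := tendsD (tendsM hc hL) herr; rewrite addr0.
by apply: tends_eq => n; rewrite thE.
Qed.

End TripleProduct.

(** * Trisection of phi *)

Lemma cube_root_norm (K : numDomainType) (w : K) :
  1 + w + w ^+ 2 = 0 -> `|w| = 1 /\ w ^+ 3 = 1.
Proof.
move=> w1; have w3 : w ^+ 3 = 1.
  have : w ^+ 3 - 1 = 0 by rewrite -[RHS](mulr0 (w - 1)) -w1; ring.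
  by move/eqP; rewrite subr_eq0 => /eqP.
split=> //; apply/eqP; rewrite -(@pexpr_eq1 _ _ 3)//.
by rewrite -normrX w3 normr1.
Qed.

Definition phi (K : numFieldType) (x : K) := eulerf x 1 ^+ 2 / eulerf x 2.

Section FiniteProducts.
Variable K : numFieldType.
Implicit Types (x q w : K).

Lemma prod_odd x N : `|x| < 1 ->
  \prod_(0 <= j < N) (1 - x ^+ (2 * j).+1) = poch x (2 * N) / poch (x ^+ 2) N.
Proof.
move=> x1; have x2 : `|x ^+ 2| < 1 by rewrite normrX exprn_ilt1.
elim: N => [|N IHN]; first by rewrite big_geq// muln0 !poch0 divr1.
rewrite big_nat_recr//= IHN mulnS !addSn add0n !pochS.
rewrite -(exprM x 2 N.+1) mulnS !addSn add0n.
have h1 := poch_neq0 N x2; have h2 := @sub1X_neq0 _ x (2 * N).+2 x1 isT.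
by field; rewrite h1 h2.
Qed.

(** Residues 1 and 5 are those prime to 6: inclusion-exclusion over the multiples of 2, 3 and 6, all
    cut at exponent 6N. *)
Lemma prod_1_5_mod6 q N : `|q| < 1 ->
  \prod_(0 <= j < N) ((1 - q ^+ (6 * j + 1)) * (1 - q ^+ (6 * j + 5))) =
  poch q (6 * N) * poch (q ^+ 6) N /
    (poch (q ^+ 2) (3 * N) * poch (q ^+ 3) (2 * N)).
Proof.
move=> q1; have qk k : (0 < k)%N -> `|q ^+ k| < 1.
  by move=> k0; rewrite normrX exprn_ilt1// -lt0n.
elim: N => [|N IHN]; first by rewrite big_geq// !muln0 !poch0 !mulr1 divr1.
rewrite big_nat_recr//= IHN !mulnS !(addSn, add0n, addnS, addn0) !pochS.
rewrite -!exprM.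
have -> : (6 * N.+1 = (6 * N).+4.+2)%N by lia.
have -> : (2 * (3 * N).+1 = (6 * N).+2)%N by lia.
have -> : (2 * (3 * N).+2 = (6 * N).+4)%N by lia.
have -> : (2 * (3 * N).+3 = (6 * N).+4.+2)%N by lia.
have -> : (3 * (2 * N).+1 = (6 * N).+3)%N by lia.
have -> : (3 * (2 * N).+2 = (6 * N).+4.+2)%N by lia.
have h1 := poch_neq0 (3 * N) (qk 2%N isT).
have h2 := poch_neq0 (2 * N) (qk 3%N isT).
have h3 := @sub1X_neq0 _ q (6 * N).+2 q1 isT.
have h4 := @sub1X_neq0 _ q (6 * N).+3 q1 isT.
have h5 := @sub1X_neq0 _ q (6 * N).+4 q1 isT.
have h6 := @sub1X_neq0 _ q (6 * N).+4.+2 q1 isT.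
move: h1 h2 h3 h4 h5 h6.
move: (poch _ (3 * N)) (poch _ (2 * N)) => p p'.
move: (1 - q ^+ (6 * N).+2) (1 - q ^+ (6 * N).+3) => z1 z2.
move: (1 - q ^+ (6 * N).+4) (1 - q ^+ (6 * N).+4.+2) => z3 z4.
by move=> h1 h2 h3 h4 h5 h6; field; rewrite h1 h2 h3 h4 h5 h6.
Qed.

(** At an exponent j prime to 3 the three factors multiply to 1 - x^(3j); at a multiple of 3 they
    coincide and give a cube. Hence the induction advances by three exponents at a time. *)
Lemma prod_cube_roots x w N : `|x| < 1 -> 1 + w + w ^+ 2 = 0 ->
  poch x (3 * N) * poch (w * x) (3 * N) * poch (w ^+ 2 * x) (3 * N) =
  poch (x ^+ 3) (3 * N) * poch (x ^+ 3) N ^+ 3 / poch (x ^+ 9) N.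
Proof.
move=> x1 w1; have [_ w3] := cube_root_norm w1.
have x9 : `|x ^+ 9| < 1 by rewrite normrX exprn_ilt1.
elim: N => [|N IHN]; first by rewrite muln0 !poch0 expr1n !mulr1 divr1.
rewrite mulnS !addSn add0n !pochS.
have three j : (1 - x ^+ j) * (1 - w * x ^+ j) * (1 - w ^+ 2 * x ^+ j) =
    1 - (x ^+ 3) ^+ j.
  rewrite -exprM mulnC exprM; move: (x ^+ j) => z.
  have -> : (1 - z) * (1 - w * z) * (1 - w ^+ 2 * z) =
    1 - w ^+ 3 * z ^+ 3 - z * (1 + w + w ^+ 2) + z ^+ 2 * w * (1 + w + w ^+ 2).
    by ring.
  by rewrite w1 w3; ring.
have wk n m : w ^+ (3 * n + m) = w ^+ m by rewrite exprD exprM w3 expr1n mul1r.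
have three' j : (1 - x ^+ j) * (1 - w ^+ 2 * x ^+ j) * (1 - w * x ^+ j) =
    1 - (x ^+ 3) ^+ j by rewrite -three; ring.
have e1 : (w * x) ^+ (3 * N).+1 = w * x ^+ (3 * N).+1.
  by rewrite exprMn -(addn1 (3 * N)) wk expr1.
have e2 : (w * x) ^+ (3 * N).+2 = w ^+ 2 * x ^+ (3 * N).+2.
  by rewrite exprMn -(addn2 (3 * N)) wk.
have e3 : (w * x) ^+ (3 * N).+3 = x ^+ (3 * N).+3.
  by rewrite exprMn -(addn3 (3 * N)) wk w3 mul1r.
have e4 : (w ^+ 2 * x) ^+ (3 * N).+1 = w ^+ 2 * x ^+ (3 * N).+1.
  rewrite exprMn -exprM (_ : (2 * (3 * N).+1 = 3 * (2 * N) + 2)%N) ?wk//; lia.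
have e5 : (w ^+ 2 * x) ^+ (3 * N).+2 = w * x ^+ (3 * N).+2.
  rewrite exprMn -exprM (_ : (2 * (3 * N).+2 = 3 * (2 * N).+1 + 1)%N) ?wk//; lia.
have e6 : (w ^+ 2 * x) ^+ (3 * N).+3 = x ^+ (3 * N).+3.
  rewrite exprMn -exprM (_ : (2 * (3 * N).+3 = 3 * (2 * N).+2 + 0)%N).
    by rewrite wk mul1r.
  by lia.
rewrite {}e1 {}e2 {}e3 {}e4 {}e5 {}e6.
have f1 : x ^+ (3 * N).+3 = (x ^+ 3) ^+ N.+1.
  by rewrite -exprM; congr (_ ^+ _); lia.
have f2 : (x ^+ 9) ^+ N.+1 = (x ^+ 3) ^+ (3 * N).+3.
  by rewrite -!exprM; congr (_ ^+ _); lia.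
have h1 := poch_neq0 N x9; have h2 := @sub1X_neq0 _ _ N.+1 x9 isT.
have t1 := three (3 * N).+1; have t2 := three' (3 * N).+2.
rewrite f2 in h2; rewrite {}f1 {}f2.
transitivity ((poch x (3 * N) * poch (w * x) (3 * N) * poch (w ^+ 2 * x) (3 * N))
  * (1 - (x ^+ 3) ^+ (3 * N).+1) * (1 - (x ^+ 3) ^+ (3 * N).+2)
  * (1 - (x ^+ 3) ^+ N.+1) ^+ 3); first by rewrite -t1 -t2; ring.
rewrite IHN; move: h1 h2; move: (poch (x ^+ 9) N) => p.
move: (1 - (x ^+ 3) ^+ (3 * N).+3) => z h1 h2.
by field; rewrite h1 h2.
Qed.

Lemma theta_term_sq x k : theta_term (- x) (- x) k = (- 1) ^+ k * x ^+ (k * k).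
Proof.
elim: k => [|k IHk]; first by rewrite theta_term0 mulr1.
rewrite theta_termS IHk mulrNN -expr2 -exprM.
have -> : (k.+1 * k.+1 = k * k + (2 * k).+1)%N by lia.
rewrite exprD 2!exprS; ring.
Qed.

(** With n = k + 1 the exponent is n(3n - 2), and (3n - 1)^2 = 3 n(3n - 2) + 1. The companion
    exponent n(3n + 2) belongs likewise to (3n + 1)^2. *)
Lemma theta_term_1_5 q k :
  theta_term (- q) (- q ^+ 5) k.+1 = (- 1) ^+ k.+1 * q ^+ (k.+1 * (3 * k).+1).
Proof.
elim: k => [|k IHk]; first by rewrite theta_termS theta_term0 !expr0; ring.
rewrite theta_termS IHk mulrNN -exprS -exprM.
have -> : (k.+2 * (3 * k.+1).+1 = k.+1 * (3 * k).+1 + (6 * k.+1).+1)%N by lia.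
rewrite exprD [(-1) ^+ k.+2]exprS [q ^+ (6 * k.+1).+1]exprS; ring.
Qed.

Lemma theta_term_5_1 q k :
  theta_term (- q ^+ 5) (- q) k.+1 = (- 1) ^+ k.+1 * q ^+ (k.+1 * (3 * k + 5)).
Proof.
elim: k => [|k IHk]; first by rewrite theta_termS theta_term0 !expr0; ring.
rewrite theta_termS IHk mulrNN -exprSr -exprM.
have -> : (k.+2 * (3 * k.+1 + 5) = k.+1 * (3 * k + 5) + (6 * k.+1 + 5))%N by lia.
rewrite 2!exprD [(-1) ^+ k.+2]exprS; ring.
Qed.

(** The indices 3m + 1 between -(3N + 1) and 3N + 1 are exactly those with m from -N to N, and
    negation exchanges them with the residue 2. The cutoff 3N + 1 thus leaves no boundary term, and
    the symmetry gives the factor 2. *)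
Lemma theta_partial_trisect x N :
  theta_partial (- x) (- x) (3 * N).+1 =
  theta_partial (- x ^+ 9) (- x ^+ 9) N
  - 2 * x * theta_partial (- x ^+ 3) (- (x ^+ 3) ^+ 5) N.
Proof.
elim: N => [|N IHN].
  rewrite muln0 /theta_partial big_nat_recr//= !big_geq// theta_termS theta_term0.
  by rewrite expr0; ring.
have rec c d M : theta_partial c d M.+1 =
    theta_partial c d M + (theta_term c d M.+1 + theta_term d c M.+1) :> K.
  by rewrite /theta_partial big_nat_recr//= addrA.
rewrite mulnS !addSn add0n 3!rec IHN 2!rec !theta_term_sq.
rewrite theta_term_1_5 theta_term_5_1 -!exprM.
have -> : ((3 * N).+2 * (3 * N).+2 = (3 * (N.+1 * (3 * N).+1)).+1)%N by lia.
have -> : ((3 * N).+4 * (3 * N).+4 = (3 * (N.+1 * (3 * N + 5))).+1)%N by lia.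
have -> : ((3 * N).+3 * (3 * N).+3 = 9 * (N.+1 * N.+1))%N by lia.
have sgn : (- 1) ^+ (3 * N) = (- 1) ^+ N :> K.
  by rewrite exprM; congr (_ ^+ _); ring.
rewrite (exprS x (3 * (N.+1 * (3 * N).+1))) (exprS x (3 * (N.+1 * (3 * N + 5)))).
rewrite [(-1) ^+ (3 * N).+2]exprS [(-1) ^+ (3 * N).+4]exprS.
rewrite [(-1) ^+ (3 * N).+3]exprS [(-1) ^+ (3 * N).+2]exprS.
rewrite [(-1) ^+ (3 * N).+1]exprS sgn [(-1) ^+ N.+1]exprS.
move: (x ^+ (3 * _)) (x ^+ (3 * _)) (x ^+ (9 * _)) => X1 X2 X3.
by ring.
Qed.

End FiniteProducts.

(* Stated over an abstract field because [field] is very slow when its atoms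
   are values of [eulerf]. *)
Section FieldIdentities.
Variable F : fieldType.
Implicit Types (u v s t : F).

Lemma phi_split u v : v != 0 -> u ^+ 2 / v = v * (u / v) ^+ 2.
Proof. by move=> v0; field. Qed.

Lemma theta15_split u v s t : s != 0 -> t != 0 ->
  u * v ^+ 2 / (s * t) = v * (u * v / (s * t)).
Proof. by move=> s0 t0; field; rewrite s0 t0. Qed.

Lemma phi_cube_roots_value u1 u2 u3 v1 v2 v3 u v s t :
  u1 * u2 * u3 = u ^+ 4 / v -> v1 * v2 * v3 = s ^+ 4 / t ->
  s != 0 -> t != 0 -> v != 0 ->
  u1 ^+ 2 / v1 * (u2 ^+ 2 / v2) * (u3 ^+ 2 / v3) =
  u ^+ 8 * t / (s ^+ 4 * v ^+ 2).
Proof.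
move=> eu ev s0 t0 v0.
have -> : u1 ^+ 2 / v1 * (u2 ^+ 2 / v2) * (u3 ^+ 2 / v3) =
    (u1 * u2 * u3) ^+ 2 / (v1 * v2 * v3) by rewrite !invfM; ring.
by rewrite eu ev; field; rewrite s0 t0 v0.
Qed.

End FieldIdentities.

(* Otherwise comparing [eulerf q k] with [eulerf q m] unfolds both limits. *)
Local Opaque eulerf.

Section Trisection.
Variable R : realType.
Implicit Types (x q w : R[i]).

(** The product value of Ramanujan's f(-q, -q^5). *)
Definition theta15 q :=
  eulerf q 1 * eulerf q 6 ^+ 2 / (eulerf q 2 * eulerf q 3).

Lemma phi_theta x : `|x| < 1 -> tends (theta_partial (- x) (- x)) (phi x).
Proof.
move=> x1; have x2 := normX_lt1 x1 (ltn0Sn 1).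
have h2 := eulerf_neq0 x1 (ltn0Sn 1).
have -> : phi x = eulerf (- x * - x) 1 * (eulerf x 1 / eulerf x 2) ^+ 2.
  by rewrite mulrNN -expr2 eulerfX /phi muln1 phi_split.
apply: jacobi_triple_product; rewrite ?normrN ?(ltW x1)//.
  by rewrite mulrNN -expr2.
have h : tends (fun N => (poch x (2 * N) / poch (x ^+ 2) N) ^+ 2)
    ((eulerf x 1 / eulerf x 2) ^+ 2).
  apply/tendsX/tendsM; last by apply/tendsV/tends_eulerf.
  have := tends_eulerf x1 (ltn0Sn 0); rewrite expr1.
  move=> /(tends_subseq 0 (ltn0Sn 1)).
  by apply: tends_eq => N; rewrite addn0.
apply: tends_eq h => N; rewrite -prod_odd// expr2 -big_split /=.
apply: eq_bigr => j _.
have -> : - x * - x = x ^+ 2 by rewrite mulrNN.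
by rewrite -exprM mulNr -exprS.
Qed.

Lemma theta15_theta q : `|q| < 1 ->
  tends (theta_partial (- q) (- q ^+ 5)) (theta15 q).
Proof.
move=> q1.
have n2 := eulerf_neq0 q1 (ltn0Sn 1); have n3 := eulerf_neq0 q1 (ltn0Sn 2).
have e6 : - q * - q ^+ 5 = q ^+ 6 by rewrite mulrNN -exprS.
have -> : theta15 q = eulerf (- q * - q ^+ 5) 1 *
    (eulerf q 1 * eulerf q 6 / (eulerf q 2 * eulerf q 3)).
  by rewrite e6 eulerfX; exact: theta15_split n2 n3.
apply: jacobi_triple_product; rewrite ?e6 ?normrN ?(ltW q1)//.
- by rewrite ltW// normX_lt1.
- by rewrite normX_lt1.
have sub k m : (0 < k)%N -> (0 < m)%N ->
    tends (fun N => poch (q ^+ k) (m * N)) (eulerf q k).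
  move=> k0 m0; have := tends_subseq 0 m0 (tends_eulerf q1 k0).
  by apply: tends_eq => N; rewrite addn0.
have h : tends (fun N => poch (q ^+ 1) (6 * N) * poch (q ^+ 6) (1 * N) /
    (poch (q ^+ 2) (3 * N) * poch (q ^+ 3) (2 * N)))
    (eulerf q 1 * eulerf q 6 / (eulerf q 2 * eulerf q 3)).
  apply: tendsM; first by apply: tendsM; apply: sub.
  apply: tendsV; first exact: mulf_neq0 n2 n3.
  by apply: tendsM; apply: sub.
apply: tends_eq h => N; rewrite expr1 mul1n -prod_1_5_mod6//.
apply: eq_bigr => j _; rewrite -exprM !mulNr -exprS -exprD.
by rewrite addn1 addnC.
Qed.

Lemma phi_trisect x : `|x| < 1 ->
  phi x = phi (x ^+ 9) - 2 * x * theta15 (x ^+ 3).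
Proof.
move=> x1; have x9 := normX_lt1 x1 (ltn0Sn 8).
have x3 := normX_lt1 x1 (ltn0Sn 2).
have h1 : tends (fun N => theta_partial (- x) (- x) (3 * N + 1)) (phi x).
  exact: tends_subseq (phi_theta x1).
apply: (tends_unique h1).
have h2 := tendsB (phi_theta x9)
  (tendsM (@tends_cst R[i] (2 * x)) (theta15_theta x3)).
by apply: tends_eq h2 => N; rewrite addn1 theta_partial_trisect.
Qed.

Lemma eulerf_cube_roots x w : `|x| < 1 -> 1 + w + w ^+ 2 = 0 -> `|w| = 1 ->
  eulerf x 1 * eulerf (w * x) 1 * eulerf (w ^+ 2 * x) 1 =
  eulerf (x ^+ 3) 1 ^+ 4 / eulerf (x ^+ 3) 3.
Proof.
move=> x1 w1 nw; have x3 := normX_lt1 x1 (ltn0Sn 2).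
have wx : `|w * x| < 1 by rewrite normrM nw mul1r.
have wwx : `|w ^+ 2 * x| < 1 by rewrite normrM normrX nw expr1n mul1r.
have n3 := eulerf_neq0 x3 (ltn0Sn 2).
have sub (z : R[i]) m : `|z| < 1 -> (0 < m)%N ->
    tends (fun N => poch z (m * N)) (eulerf z 1).
  move=> z1 m0; have := tends_subseq 0 m0 (tends_eulerf z1 (ltn0Sn 0)).
  by apply: tends_eq => N; rewrite addn0 expr1.
have h := tendsM (tendsM (sub _ _ x1 (ltn0Sn 2)) (sub _ _ wx (ltn0Sn 2)))
  (sub _ _ wwx (ltn0Sn 2)).
apply: (tends_unique h).
have h9 := tends_eulerf x3 (ltn0Sn 2).
have h1 := tends_eulerf x3 (ltn0Sn 0); rewrite expr1 in h1.
have h' := tendsM (tendsM (sub _ _ x3 (ltn0Sn 2)) (tendsX (k := 3%N) h1))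
  (tendsV n3 h9).
rewrite (exprS _ 3).
by apply: tends_eq h' => N; rewrite (prod_cube_roots N x1 w1) -exprM.
Qed.

Lemma phi_cube_roots x w : `|x| < 1 -> 1 + w + w ^+ 2 = 0 -> `|w| = 1 ->
  phi x * phi (w * x) * phi (w ^+ 2 * x) =
  eulerf (x ^+ 3) 1 ^+ 8 * eulerf (x ^+ 3) 6 /
    (eulerf (x ^+ 3) 2 ^+ 4 * eulerf (x ^+ 3) 3 ^+ 2).
Proof.
move=> x1 w1 nw.
have x2 := normX_lt1 x1 (ltn0Sn 1); have x3 := normX_lt1 x1 (ltn0Sn 2).
(* The denominators of the three phi's involve x^2 and (w x)^2 = w^2 x^2, so the cube-root product
   is applied a second time with x^2 and the root w^2. *)
have w2 : 1 + w ^+ 2 + (w ^+ 2) ^+ 2 = 0.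
  by rewrite -[RHS](mulr0 (1 - w + w ^+ 2)) -w1; ring.
have nw2 : `|w ^+ 2| = 1 by rewrite normrX nw expr1n.
have e1 := eulerf_cube_roots x1 w1 nw.
have e2 : eulerf x 2 * eulerf (w * x) 2 * eulerf (w ^+ 2 * x) 2 =
    eulerf (x ^+ 3) 2 ^+ 4 / eulerf (x ^+ 3) 6.
  have c2 z : eulerf (z ^+ 2) 1 = eulerf z 2 := eulerfX z 2 1.
  have c6 : eulerf ((x ^+ 2) ^+ 3) 1 = eulerf (x ^+ 3) 2.
    by rewrite exprAC c2.
  have c18 : eulerf ((x ^+ 2) ^+ 3) 3 = eulerf (x ^+ 3) 6.
    by rewrite exprAC; exact: (eulerfX (x ^+ 3) 2 3).
  have := eulerf_cube_roots x2 w2 nw2.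
  by rewrite -!exprMn !c2 c6 c18.
have n2 := eulerf_neq0 x3 (ltn0Sn 1); have n3 := eulerf_neq0 x3 (ltn0Sn 2).
have n6 := eulerf_neq0 x3 (ltn0Sn 5).
rewrite /phi; exact: phi_cube_roots_value e1 e2 n2 n6 n3.
Qed.

End Trisection.

(** * The generating function *)

Section SchurIdentities.
Variable F : fieldType.
Implicit Types (u v w x q a b : F).

Lemma schur_euler_ratio e1 e2 e4 et e2t e4t : e1 != 0 -> e2 != 0 -> e4 != 0 ->
  e2t != 0 -> e4t != 0 ->
  e2 ^+ 3 / (e1 ^+ 2 * e4) * (et ^+ 2 * e4t / e2t ^+ 3) =
  e2 / e4 * (et / e2t) ^+ 2 / ((e1 / e2) ^+ 2 * (e2t / e4t)) :> F.
Proof. by move=> n1 n2 n4 n2t n4t; field; rewrite n1 n2 n4 n2t n4t. Qed.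

Lemma schur_product_step (o1 o2 o3 o4 z1 z2 : F) : o1 != 0 -> o4 != 0 ->
  1 - z1 != 0 -> 1 + z1 != 0 -> 1 - z2 != 0 -> 1 + z2 != 0 ->
  o2 * (1 - z1 ^+ 2) * (o3 * (1 - z2)) ^+ 2 /
    ((o1 * (1 - z1)) ^+ 2 * (o4 * (1 - z2 ^+ 2))) =
  o2 * o3 ^+ 2 / (o1 ^+ 2 * o4) *
    (((1 + z1) * (1 - z2)) / ((1 + z2) * (1 - z1))).
Proof.
move=> h1 h4 k1 k2 k3 k4.
have -> : 1 - z1 ^+ 2 = (1 - z1) * (1 + z1) by ring.
have -> : 1 - z2 ^+ 2 = (1 - z2) * (1 + z2) by ring.
by field; rewrite h1 h4 k1 k3 k4.
Qed.

Lemma phi_quotient e1 e2 e4 : e1 != 0 -> e2 != 0 -> e4 != 0 ->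
  e2 ^+ 3 / (e1 ^+ 2 * e4) = (e2 ^+ 2 / e4) / (e1 ^+ 2 / e2) :> F.
Proof. by move=> n1 n2 n4; field; rewrite n1 n2 n4. Qed.

Lemma conjugate_product a b x w : 1 + w + w ^+ 2 = 0 -> w ^+ 3 = 1 ->
  (a - 2 * (w * x) * b) * (a - 2 * (w ^+ 2 * x) * b) =
  a ^+ 2 + 2 * x * a * b + 4 * x ^+ 2 * b ^+ 2.
Proof.
move=> w1 w3.
have -> : (a - 2 * (w * x) * b) * (a - 2 * (w ^+ 2 * x) * b) =
    a ^+ 2 + 2 * x * a * b - 2 * x * a * b * (1 + w + w ^+ 2)
    + 4 * x ^+ 2 * b ^+ 2 * w ^+ 3 by ring.
by rewrite w1 w3; ring.
Qed.

(** Write A' - 2 x^2 B' for the first factor and A^2 + 2 x A B + 4 x^2 B^2 for the second. The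
    product has degree 4 in x, and x^3 = q, x^4 = q x fall back on residues 0 and 1. The three
    numerators are A' A^2 - 4 q A B B', 2 A' A B - 8 q B^2 B' and 4 A' B^2 - 2 A^2 B'. *)
Lemma trisected_value x (f1 f2 f3 f4 f6 f12 fl f2l f4l : F) :
  f1 != 0 -> f2 != 0 -> f3 != 0 -> f4 != 0 -> f6 != 0 -> f12 != 0 ->
  f2l != 0 ->
  (f6 ^+ 2 / f12 - 2 * x ^+ 2 * (f2 * f12 ^+ 2 / (f4 * f6))) *
    ((f3 ^+ 2 / f6) ^+ 2
     + 2 * x * (f3 ^+ 2 / f6) * (f1 * f6 ^+ 2 / (f2 * f3))
     + 4 * x ^+ 2 * (f1 * f6 ^+ 2 / (f2 * f3)) ^+ 2) /
    (f1 ^+ 8 * f6 / (f2 ^+ 4 * f3 ^+ 2)) *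
    (fl ^+ 2 * f4l / f2l ^+ 3) =
  ((f2 ^+ 4 * f3 ^+ 6 * fl ^+ 2 * f4l) / (f1 ^+ 8 * f6 * f12 * f2l ^+ 3)
   - 4 * x ^+ 3 * ((f2 ^+ 4 * f3 ^+ 3 * f12 ^+ 2 * fl ^+ 2 * f4l)
       / (f1 ^+ 7 * f4 * f6 * f2l ^+ 3)))
  + x * (2 * ((f2 ^+ 3 * f3 ^+ 3 * f6 ^+ 2 * fl ^+ 2 * f4l)
           / (f1 ^+ 7 * f2l ^+ 3 * f12))
         - 8 * x ^+ 3 * ((f2 ^+ 3 * f6 ^+ 2 * f12 ^+ 2 * fl ^+ 2 * f4l)
             / (f1 ^+ 6 * f4 * f2l ^+ 3)))
  + x ^+ 2 * (4 * ((f2 ^+ 2 * f6 ^+ 5 * fl ^+ 2 * f4l)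
                / (f1 ^+ 6 * f2l ^+ 3 * f12))
              - 2 * ((f2 ^+ 5 * f3 ^+ 6 * f12 ^+ 2 * fl ^+ 2 * f4l)
                  / (f1 ^+ 8 * f6 ^+ 4 * f4 * f2l ^+ 3))).
Proof.
move=> n1 n2 n3 n4 n6 n12 nl.
by field; rewrite n1 n2 n3 n4 n6 n12 nl.
Qed.

(** Here [p] stands for phi(x^2), and [p1], [p2], [p3] for phi at x, w x, w^2 x; multiplying
    numerator and denominator by [p2 * p3] rationalises the quotient. *)
Lemma trisected_quotient x w (p p1 p2 p3 : F)
    (f1 f2 f3 f4 f6 f12 fl f2l f4l : F) :
  f1 != 0 -> f2 != 0 -> f3 != 0 -> f4 != 0 -> f6 != 0 -> f12 != 0 ->
  f2l != 0 -> p1 != 0 -> p2 != 0 -> p3 != 0 ->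
  1 + w + w ^+ 2 = 0 -> w ^+ 3 = 1 ->
  p1 * p2 * p3 = f1 ^+ 8 * f6 / (f2 ^+ 4 * f3 ^+ 2) ->
  p = f6 ^+ 2 / f12 - 2 * x ^+ 2 * (f2 * f12 ^+ 2 / (f4 * f6)) ->
  p2 = f3 ^+ 2 / f6 - 2 * (w * x) * (f1 * f6 ^+ 2 / (f2 * f3)) ->
  p3 = f3 ^+ 2 / f6 - 2 * (w ^+ 2 * x) * (f1 * f6 ^+ 2 / (f2 * f3)) ->
  p / p1 * (fl ^+ 2 * f4l / f2l ^+ 3) =
  ((f2 ^+ 4 * f3 ^+ 6 * fl ^+ 2 * f4l) / (f1 ^+ 8 * f6 * f12 * f2l ^+ 3)
   - 4 * x ^+ 3 * ((f2 ^+ 4 * f3 ^+ 3 * f12 ^+ 2 * fl ^+ 2 * f4l)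
       / (f1 ^+ 7 * f4 * f6 * f2l ^+ 3)))
  + x * (2 * ((f2 ^+ 3 * f3 ^+ 3 * f6 ^+ 2 * fl ^+ 2 * f4l)
           / (f1 ^+ 7 * f2l ^+ 3 * f12))
         - 8 * x ^+ 3 * ((f2 ^+ 3 * f6 ^+ 2 * f12 ^+ 2 * fl ^+ 2 * f4l)
             / (f1 ^+ 6 * f4 * f2l ^+ 3)))
  + x ^+ 2 * (4 * ((f2 ^+ 2 * f6 ^+ 5 * fl ^+ 2 * f4l)
                / (f1 ^+ 6 * f2l ^+ 3 * f12))
              - 2 * ((f2 ^+ 5 * f3 ^+ 6 * f12 ^+ 2 * fl ^+ 2 * f4l)
                  / (f1 ^+ 8 * f6 ^+ 4 * f4 * f2l ^+ 3))).
Proof.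
move=> n1 n2 n3 n4 n6 n12 nl m1 m2 m3 w1 w3 e123 ep e2 e3.
have -> : p / p1 = p * (p2 * p3) / (p1 * p2 * p3).
  by field; rewrite m1 m2 m3.
by rewrite e123 ep e2 e3 (conjugate_product _ _ _ w1 w3) trisected_value.
Qed.

Lemma quot_neq0 u v : u != 0 -> v != 0 -> u / v != 0.
Proof. by move=> u0 v0; rewrite mulf_neq0 ?invr_eq0. Qed.

Lemma sqr_quot_mul_neq0 (s t u v : F) :
  s != 0 -> t != 0 -> u != 0 -> v != 0 -> (s / t) ^+ 2 * (u / v) != 0.
Proof. by move=> *; rewrite mulf_neq0 ?expf_neq0 ?quot_neq0. Qed.

End SchurIdentities.

Section OddProduct.
Variable K : numFieldType.
Implicit Types q z : K.

Definition odd_poch z N := \prod_(0 <= j < N) (1 - z ^+ (2 * j).+1).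

Lemma odd_poch_neq0 z N : `|z| < 1 -> odd_poch z N != 0.
Proof.
move=> z1; rewrite /odd_poch prod_odd//; apply: quot_neq0; apply: poch_neq0 => //.
by rewrite normrX exprn_ilt1.
Qed.

(** Each 1 + z is (1 - z^2) / (1 - z), which leaves only products over odd exponents, at q, q^2, q^t
    and q^(2t). *)
Lemma schur_product_finite q t N : `|q| < 1 -> (0 < t)%N ->
  \prod_(1 <= n < N.+1)
    ((1 + q ^+ (2 * n - 1)%N) * (1 - q ^+ (t * (2 * n - 1))%N)
     / ((1 + q ^+ (t * (2 * n - 1))%N) * (1 - q ^+ (2 * n - 1)%N))) =
  odd_poch (q ^+ 2) N * odd_poch (q ^+ t) N ^+ 2 /
    (odd_poch q N ^+ 2 * odd_poch (q ^+ t ^+ 2) N).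
Proof.
move=> q1 t0; have lt1 (z : K) k : `|z| < 1 -> (0 < k)%N -> `|z ^+ k| < 1.
  by move=> z1 k0; rewrite normrX exprn_ilt1// -lt0n.
have qt := lt1 _ _ q1 t0; have qt2 := lt1 _ 2%N qt isT.
elim: N => [|N IHN].
  by rewrite /odd_poch !big_geq// expr1n !mulr1 divr1.
have S (z : K) : odd_poch z N.+1 = odd_poch z N * (1 - z ^+ (2 * N).+1).
  by rewrite /odd_poch big_nat_recr.
rewrite big_nat_recr//= IHN !S.
have -> : (2 * N.+1 - 1 = (2 * N).+1)%N by lia.
have k1 := @sub1X_neq0 _ _ (2 * N).+1 q1 isT.
have k2 := @add1X_neq0 _ _ (2 * N).+1 q1 isT.
have k3 := @sub1X_neq0 _ _ (2 * N).+1 qt isT.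
have k4 := @add1X_neq0 _ _ (2 * N).+1 qt isT.
rewrite (exprAC q 2) (exprAC (q ^+ t) 2) exprM.
by rewrite (schur_product_step _ _ _ _ k1 k2 k3 k4) ?odd_poch_neq0.
Qed.

End OddProduct.

(** The family [f] is a parameter separate from [q], so that the expression can be followed along a
    sequence of families converging termwise. *)
Definition schur_part0 (K : numFieldType) (f : nat -> K) (l : nat) (q : K) :=
  (f 2%N ^+ 4 * f 3%N ^+ 6 * f l ^+ 2 * f (4 * l)%N)
    / (f 1%N ^+ 8 * f 6%N * f 12%N * f (2 * l)%N ^+ 3)
  - 4 * q * ((f 2%N ^+ 4 * f 3%N ^+ 3 * f 12%N ^+ 2 * f l ^+ 2 * f (4 * l)%N)
    / (f 1%N ^+ 7 * f 4%N * f 6%N * f (2 * l)%N ^+ 3)).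

Definition schur_part1 (K : numFieldType) (f : nat -> K) (l : nat) (q : K) :=
  2 * ((f 2%N ^+ 3 * f 3%N ^+ 3 * f 6%N ^+ 2 * f l ^+ 2 * f (4 * l)%N)
    / (f 1%N ^+ 7 * f (2 * l)%N ^+ 3 * f 12%N))
  - 8 * q * ((f 2%N ^+ 3 * f 6%N ^+ 2 * f 12%N ^+ 2 * f l ^+ 2 * f (4 * l)%N)
    / (f 1%N ^+ 6 * f 4%N * f (2 * l)%N ^+ 3)).

Definition schur_part2 (K : numFieldType) (f : nat -> K) (l : nat) (q : K) :=
  4 * ((f 2%N ^+ 2 * f 6%N ^+ 5 * f l ^+ 2 * f (4 * l)%N)
    / (f 1%N ^+ 6 * f (2 * l)%N ^+ 3 * f 12%N))
  - 2 * ((f 2%N ^+ 5 * f 3%N ^+ 6 * f 12%N ^+ 2 * f l ^+ 2 * f (4 * l)%N)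
    / (f 1%N ^+ 8 * f 6%N ^+ 4 * f 4%N * f (2 * l)%N ^+ 3)).

Section SchurProduct.
Variable R : realType.
Implicit Types (x q w : R[i]).

Lemma odd_poch_tends z : `|z| < 1 ->
  tends (odd_poch (z : R[i])) (eulerf z 1 / eulerf z 2).
Proof.
move=> z1; have h := tends_subseq 0 (ltn0Sn 1) (tends_eulerf z1 (ltn0Sn 0)).
have := tendsM h (tendsV (eulerf_neq0 z1 (ltn0Sn 1)) (tends_eulerf z1 (ltn0Sn 1))).
by apply: tends_eq => N; rewrite expr1 addn0 /odd_poch prod_odd.
Qed.

Lemma schur_productE t q : `|q| < 1 -> (0 < t)%N ->
  schur_product t q =
  eulerf q 2 ^+ 3 / (eulerf q 1 ^+ 2 * eulerf q 4) *
  (eulerf q t ^+ 2 * eulerf q (4 * t) / eulerf q (2 * t) ^+ 3).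
Proof.
move=> q1 t0.
have n2 := eulerf_neq0 q1 (ltn0Sn 1); have n1 := eulerf_neq0 q1 (ltn0Sn 0).
have n4 := eulerf_neq0 q1 (ltn0Sn 3).
have k2t : (0 < 2 * t)%N by rewrite muln_gt0.
have k4t : (0 < 4 * t)%N by rewrite muln_gt0.
have n2t := eulerf_neq0 q1 k2t; have n4t := eulerf_neq0 q1 k4t.
have q2 := normX_lt1 q1 (ltn0Sn 1); have qt := normX_lt1 q1 t0.
have qt2 := normX_lt1 qt (ltn0Sn 1).
have c k (z : R[i]) : eulerf (z ^+ k) 1 = eulerf z k by rewrite eulerfX muln1.
have c4 (z : R[i]) : eulerf (z ^+ 2) 2 = eulerf z 4 := eulerfX z 2 2.
have h1 := odd_poch_tends q1; have h2 := odd_poch_tends q2.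
have h3 := odd_poch_tends qt; have h4 := odd_poch_tends qt2.
rewrite c c4 in h2; rewrite c eulerfX (mulnC t) in h3.
rewrite c c4 2!eulerfX 2!(mulnC t) in h4.
rewrite (schur_euler_ratio _ n1 n2 n4 n2t n4t) /schur_product /infprod.
have nt := sqr_quot_mul_neq0 n1 n2 n2t n4t.
have h := tendsM (tendsM h2 (tendsX (k := 2%N) h3))
  (tendsV nt (tendsM (tendsX (k := 2%N) h1) h4)).
apply: tends_lim; apply: tends_eq h => N.
by rewrite (schur_product_finite _ q1 t0).
Qed.

Lemma phi_neq0 x : `|x| < 1 -> phi x != 0.
Proof.
move=> x1; rewrite /phi; apply: quot_neq0; last exact: eulerf_neq0 x1 (ltn0Sn 1).
by apply: expf_neq0; exact: eulerf_neq0 x1 (ltn0Sn 0).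
Qed.

(** The coefficients depend on q alone, hence are shared by the conjugates w x and w^2 x; the case
    of x^2 is covered with q^2 in place of q. *)
Lemma phi_trisect_cube x q : `|x| < 1 -> x ^+ 3 = q ->
  phi x = eulerf q 3 ^+ 2 / eulerf q 6
          - 2 * x * (eulerf q 1 * eulerf q 6 ^+ 2 / (eulerf q 2 * eulerf q 3)).
Proof.
move=> x1 xq; rewrite (phi_trisect x1) xq.
have c3 : eulerf (q ^+ 3) 1 = eulerf q 3 := eulerfX q 3 1.
have c6 : eulerf (q ^+ 3) 2 = eulerf q 6 := eulerfX q 3 2.
have -> : x ^+ 9 = q ^+ 3 by rewrite -xq (exprM x 3 3).
by rewrite /phi /theta15 c3 c6.
Qed.

Lemma schur_trisect x w l : `|x| < 1 -> (0 < l)%N -> 1 + w + w ^+ 2 = 0 ->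
  schur_product (3 * l) x =
  schur_part0 (eulerf (x ^+ 3)) l (x ^+ 3)
  + x * schur_part1 (eulerf (x ^+ 3)) l (x ^+ 3)
  + x ^+ 2 * schur_part2 (eulerf (x ^+ 3)) l (x ^+ 3).
Proof.
move=> x1 l0 w1; have [nw w3] := cube_root_norm w1.
have x2 := normX_lt1 x1 (ltn0Sn 1); have q1 := normX_lt1 x1 (ltn0Sn 2).
have wx : `|w * x| < 1 by rewrite normrM nw mul1r.
have wwx : `|w ^+ 2 * x| < 1 by rewrite normrM normrX nw expr1n mul1r.
have l3 : (0 < 3 * l)%N by rewrite muln_gt0.
have k2l : (0 < 2 * l)%N by rewrite muln_gt0.
rewrite (schur_productE x1 l3).
have cl : eulerf x (3 * l) = eulerf (x ^+ 3) l by rewrite eulerfX.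
have c4l : eulerf x (4 * (3 * l)) = eulerf (x ^+ 3) (4 * l).
  by rewrite eulerfX mulnCA.
have c2l : eulerf x (2 * (3 * l)) = eulerf (x ^+ 3) (2 * l).
  by rewrite eulerfX mulnCA.
have n1 := eulerf_neq0 x1 (ltn0Sn 0); have n2 := eulerf_neq0 x1 (ltn0Sn 1).
have n4 := eulerf_neq0 x1 (ltn0Sn 3).
rewrite cl c4l c2l (phi_quotient n1 n2 n4).
have c2 : eulerf (x ^+ 2) 1 = eulerf x 2 := eulerfX x 2 1.
have c4 : eulerf (x ^+ 2) 2 = eulerf x 4 := eulerfX x 2 2.
have p2 := phi_trisect_cube x2 (exprAC x 2 3).
rewrite {1}/phi c2 c4 in p2.
have d1 : eulerf (x ^+ 3 ^+ 2) 1 = eulerf (x ^+ 3) 2 := eulerfX (x ^+ 3) 2 1.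
have d2 : eulerf (x ^+ 3 ^+ 2) 2 = eulerf (x ^+ 3) 4 := eulerfX (x ^+ 3) 2 2.
have d3 : eulerf (x ^+ 3 ^+ 2) 3 = eulerf (x ^+ 3) 6 := eulerfX (x ^+ 3) 2 3.
have d6 : eulerf (x ^+ 3 ^+ 2) 6 = eulerf (x ^+ 3) 12 := eulerfX (x ^+ 3) 2 6.
rewrite d1 d2 d3 d6 in p2.
have wx3 : (w * x) ^+ 3 = x ^+ 3 by rewrite exprMn w3 mul1r.
have wwx3 : (w ^+ 2 * x) ^+ 3 = x ^+ 3.
  by rewrite exprMn (exprAC w 2 3) w3 expr1n mul1r.
rewrite /schur_part0 /schur_part1 /schur_part2.
exact: trisected_quotient
  (eulerf_neq0 q1 (ltn0Sn 0)) (eulerf_neq0 q1 (ltn0Sn 1))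
  (eulerf_neq0 q1 (ltn0Sn 2)) (eulerf_neq0 q1 (ltn0Sn 3))
  (eulerf_neq0 q1 (ltn0Sn 5)) (eulerf_neq0 q1 (ltn0Sn 11))
  (eulerf_neq0 q1 k2l) (phi_neq0 x1) (phi_neq0 wx) (phi_neq0 wwx) w1 w3
  (phi_cube_roots x1 w1 nw) p2 (phi_trisect_cube wx wx3)
  (phi_trisect_cube wwx wwx3).
Qed.

End SchurProduct.

(** * Trisection of the power series *)

Section SeriesTrisection.
Variable K : numFieldType.
Implicit Types (x w z q : K) (a : nat -> K).

(** The three partial sums on the right depend on z only through q, hence are the same for all cube
    roots of q. *)
Lemma series_trisect a z q N : z ^+ 3 = q ->
  series (fun n => a n * z ^+ n) (3 * N)%N =
  series (fun n => a (3 * n)%N * q ^+ n) N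
  + z * series (fun n => a (3 * n + 1)%N * q ^+ n) N
  + z ^+ 2 * series (fun n => a (3 * n + 2)%N * q ^+ n) N.
Proof.
move=> zq; rewrite /series /=; elim: N => [|N IHN].
  by rewrite muln0 !big_geq// !mulr0 !addr0.
rewrite mulnS !addSn add0n !big_nat_recr//= IHN.
rewrite addn1 addn2 !exprS [z ^+ (3 * N)]exprM zq expr0.
by ring.
Qed.

(** Discrete Fourier inversion over the three cube roots, applied both to the sequences and to the
    limits; convergence of each [u0], [u1], [u2] is a conclusion. *)
Lemma tends_trisect (u0 u1 u2 : nat -> K) (a0 a1 a2 : K) x w : x != 0 ->
  1 + w + w ^+ 2 = 0 ->
  (forall z, z ^+ 3 = x ^+ 3 ->
    tends (fun n => u0 n + z * u1 n + z ^+ 2 * u2 n)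
          (a0 + z * a1 + z ^+ 2 * a2)) ->
  [/\ tends u0 a0, tends u1 a1 & tends u2 a2].
Proof.
move=> x0 w1 h; have [_ w3] := cube_root_norm w1.
have h0 := h x (erefl _).
have e1 : (w * x) ^+ 3 = x ^+ 3 by rewrite exprMn w3 mul1r.
have e2 : (w ^+ 2 * x) ^+ 3 = x ^+ 3.
  by rewrite exprMn (exprAC w 2 3) w3 expr1n mul1r.
have h1 := h _ e1; have h2 := h _ e2.
have comb (c0 c1 c2 : K) := tendsD (tendsD (tendsM (@tends_cst K c0) h0)
  (tendsM (@tends_cst K c1) h1)) (tendsM (@tends_cst K c2) h2).
(* The component of index i is extracted with weights 1, w^(-i), w^(-2i) divided by 3 x^i, where
   w^(-1) = w^2. *)
have id0 b0 b1 b2 : b0 = 3^-1 * (b0 + x * b1 + x ^+ 2 * b2)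
   + 3^-1 * (b0 + w * x * b1 + (w * x) ^+ 2 * b2)
   + 3^-1 * (b0 + w ^+ 2 * x * b1 + (w ^+ 2 * x) ^+ 2 * b2).
  have -> : 3^-1 * (b0 + x * b1 + x ^+ 2 * b2)
   + 3^-1 * (b0 + w * x * b1 + (w * x) ^+ 2 * b2)
   + 3^-1 * (b0 + w ^+ 2 * x * b1 + (w ^+ 2 * x) ^+ 2 * b2) =
   b0 + 3^-1 * (x * b1 * (1 + w + w ^+ 2)
     + x ^+ 2 * b2 * (1 + w ^+ 2 + w ^+ 3 * w)) by field.
  by rewrite w3 mul1r [1 + w ^+ 2 + w]addrAC w1 !mulr0 addr0 mulr0 addr0.
have id1 b0 b1 b2 : b1 = 3^-1 / x * (b0 + x * b1 + x ^+ 2 * b2)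
   + 3^-1 / x * w ^+ 2 * (b0 + w * x * b1 + (w * x) ^+ 2 * b2)
   + 3^-1 / x * w * (b0 + w ^+ 2 * x * b1 + (w ^+ 2 * x) ^+ 2 * b2).
  have -> : 3^-1 / x * (b0 + x * b1 + x ^+ 2 * b2)
   + 3^-1 / x * w ^+ 2 * (b0 + w * x * b1 + (w * x) ^+ 2 * b2)
   + 3^-1 / x * w * (b0 + w ^+ 2 * x * b1 + (w ^+ 2 * x) ^+ 2 * b2) =
   3^-1 * b1 * (1 + w ^+ 3 + w ^+ 3)
   + 3^-1 / x * (b0 * (1 + w + w ^+ 2)
     + x ^+ 2 * b2 * (1 + w ^+ 3 * w + w ^+ 3 * w ^+ 2)) by field.
  by rewrite w3 !mul1r w1 !mulr0 addr0 mulr0 addr0; field.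
have id2 b0 b1 b2 : b2 = 3^-1 / x ^+ 2 * (b0 + x * b1 + x ^+ 2 * b2)
   + 3^-1 / x ^+ 2 * w * (b0 + w * x * b1 + (w * x) ^+ 2 * b2)
   + 3^-1 / x ^+ 2 * w ^+ 2 * (b0 + w ^+ 2 * x * b1 + (w ^+ 2 * x) ^+ 2 * b2).
  have -> : 3^-1 / x ^+ 2 * (b0 + x * b1 + x ^+ 2 * b2)
   + 3^-1 / x ^+ 2 * w * (b0 + w * x * b1 + (w * x) ^+ 2 * b2)
   + 3^-1 / x ^+ 2 * w ^+ 2 * (b0 + w ^+ 2 * x * b1 + (w ^+ 2 * x) ^+ 2 * b2) =
   3^-1 * b2 * (1 + w ^+ 3 + w ^+ 3 * w ^+ 3)
   + 3^-1 / x ^+ 2 * (b0 * (1 + w + w ^+ 2)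
     + x * b1 * (1 + w ^+ 2 + w ^+ 3 * w)) by field.
  by rewrite w3 !mul1r [1 + w ^+ 2 + w]addrAC w1 !mulr0 addr0 mulr0 addr0; field.
split.
- rewrite [a0](id0 a0 a1 a2).
  by apply: tends_eq (comb 3^-1 3^-1 3^-1) => n; rewrite -id0.
- rewrite [a1](id1 a0 a1 a2).
  by apply: tends_eq (comb (3^-1 / x) (3^-1 / x * w ^+ 2) (3^-1 / x * w)) => n;
    rewrite -id1.
- rewrite [a2](id2 a0 a1 a2).
  by apply: tends_eq
    (comb (3^-1 / x ^+ 2) (3^-1 / x ^+ 2 * w) (3^-1 / x ^+ 2 * w ^+ 2)) => n;
    rewrite -id2.
Qed.

End SeriesTrisection.

(** * Continuity and the value at the origin *)

Section PartsContinuity.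
Variables (K : numFieldType) (f : nat -> nat -> K) (f0 : nat -> K).
Variables (y : nat -> K) (y0 : K) (l : nat).
Hypothesis l0 : (0 < l)%N.
Hypothesis hy : tends y y0.
Hypothesis hf : forall k, (0 < k)%N -> tends (fun m => f m k) (f0 k).
Hypothesis hf0 : forall k, (0 < k)%N -> f0 k != 0.

Let k2l : (0 < 2 * l)%N. Proof. by rewrite muln_gt0. Qed.
Let k4l : (0 < 4 * l)%N. Proof. by rewrite muln_gt0. Qed.

Ltac tends_parts := repeat lazymatch goal with
  | |- tends (fun m => _ ^+ _) _ => apply: tendsX
  | |- tends (fun m => _^-1) _ => apply: tendsV
  | |- tends (fun m => _ * _) _ => apply: tendsM
  | |- tends (fun m => _ - _) _ => apply: tendsB
  | |- tends (fun m => f m _) _ =>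
    first [exact: hf | exact: (hf l0) | exact: (hf k2l) | exact: (hf k4l)]
  | |- tends (fun m => y m) _ => exact: hy
  | |- tends y _ => exact: hy
  | |- tends _ _ => exact: tends_cst
  end.
Ltac nonzero_parts := repeat first
  [ exact: (hf0 k2l) | exact: hf0 | apply: expf_neq0 | apply: mulf_neq0 ].

Lemma schur_part0_tends :
  tends (fun m => schur_part0 (f m) l (y m)) (schur_part0 f0 l y0).
Proof. by rewrite /schur_part0; tends_parts; nonzero_parts. Qed.

Lemma schur_part1_tends :
  tends (fun m => schur_part1 (f m) l (y m)) (schur_part1 f0 l y0).
Proof. by rewrite /schur_part1; tends_parts; nonzero_parts. Qed.

Lemma schur_part2_tends :
  tends (fun m => schur_part2 (f m) l (y m)) (schur_part2 f0 l y0).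
Proof. by rewrite /schur_part2; tends_parts; nonzero_parts. Qed.

End PartsContinuity.

Section Origin.
Variable R : realType.
Implicit Types (u : nat -> R[i]) (y q : R[i]).

Lemma tends_normc u l (e : R) : tends u l -> 0 < e ->
  exists N, forall n, (N <= n)%N -> normc (l - u n) < e.
Proof.
move=> hu e0; have e0' : 0 < e%:C%C :> R[i] by rewrite -[0]/(0%:C%C) ltcR.
have /cvgrPdist_lt /(_ _ e0') [N _ hN] := hu.
by exists N => n /hN /=; rewrite norm_normc ltcR.
Qed.

Lemma tends_normc_le u l c (e : R) : tends u l ->
  (forall n, normc (u n - c) <= e) -> normc (l - c) <= e.
Proof.
move=> hu he; rewrite leNgt; apply/negP => h.
have /(tends_normc hu)[N /(_ N (leqnn N))] : 0 < normc (l - c) - e.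
  by rewrite subr_gt0.
apply/negP; rewrite -leNgt lerBlDr.
have -> : l - c = (l - u N) + (u N - c) by rewrite addrA subrK.
by rewrite (le_trans (le_normcD _ _))// lerD2l.
Qed.

Lemma tends_bounded u l : tends u l ->
  exists2 B : R, 0 <= B & forall n, normc (u n) <= B.
Proof.
move=> /tends_normc /(_ ltr01)[N hN].
pose s : R := \sum_(0 <= n < N) normc (u n).
have s0 : 0 <= s by apply: sumr_ge0 => n _; exact: normc_ge0.
exists (normc l + 1 + s); first by rewrite !addr_ge0 ?normc_ge0.
move=> n; have [Nn|nN] := leqP N n.
  have -> : u n = l + - (l - u n) by rewrite opprB addrC subrK.
  apply: (le_trans (le_normcD _ _)); rewrite normcN -addrA lerD2l.
  by rewrite (le_trans (ltW (hN _ Nn)))// lerDl.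
rewrite (@le_trans _ _ s)//; last by rewrite lerDr addr_ge0 ?normc_ge0.
rewrite /s (big_cat_nat _ (n := n))//= 1?ltnW// (big_ltn nN) addrCA lerDl.
by rewrite addr_ge0// sumr_ge0// => k _; exact: normc_ge0.
Qed.

Lemma geometric_increments u (c : R) : 0 <= c ->
  (forall n, normc (u n.+1 - u n) <= c * 2^-1 ^+ n.+1) ->
  forall n, normc (u n - u 0) <= c * (1 - 2^-1 ^+ n).
Proof.
move=> c0 hu; elim=> [|n IHn]; first by rewrite !subrr normc0 mulr0.
have -> : u n.+1 - u 0 = (u n.+1 - u n) + (u n - u 0) by rewrite addrA subrK.
apply: (le_trans (le_normcD _ _)).
apply: (le_trans (lerD (hu n) IHn)); rewrite exprS.
by move: (2^-1 ^+ n) => z; lra.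
Qed.

Lemma normX_quarter (r : R) n : 0 <= r <= 4^-1 ->
  r ^+ n.+1 <= 2 * r * 2^-1 ^+ n.+1.
Proof.
move=> /andP[r0 r1]; rewrite 2!exprS.
have : r ^+ n <= 2^-1 ^+ n by rewrite lerXn2r ?nnegrE//; lra.
by move=> /(ler_wpM2l r0); lra.
Qed.

Lemma eulerf_near0 q k : normc q <= 4^-1 -> (0 < k)%N ->
  normc (eulerf q k - 1) <= 4 * normc q.
Proof.
move=> q4 k0; have q0 := normc_ge0 q.
have q1 : `|q| < 1 by rewrite norm_normc -[1]/(1%:C%C) ltcR; lra.
apply: tends_normc_le (tends_eulerf q1 k0) _ => n.
have yq : normc (q ^+ k) <= normc q.
  rewrite normcX -[leRHS]expr1 ler_wiXn2l//; lra.
have y0 := normc_ge0 (q ^+ k).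
apply: (@le_trans _ _ (4 * normc (q ^+ k))); last by rewrite ler_wpM2l.
have y4 := le_trans yq q4; clear yq.
move: (q ^+ k) y4 y0 => y y4 y0.
have half m : 0 <= 2^-1 ^+ m :> R by rewrite exprn_ge0// invr_ge0.
(* A bootstrap: as |y| <= 1/4, the bound for m implies |[poch y m]| <= 2, so the next increment is
   at most 2 (2 |y| 2^-(m+1)). This is where the constant 4 comes from. *)
suff h m : normc (poch y m - 1) <= 4 * normc y * (1 - 2^-1 ^+ m).
  apply: (le_trans (h n)).
  by rewrite ler_piMr ?mulr_ge0// gerBl.
elim: m => [|m IHm]; first by rewrite poch0 !subrr normc0 mulr0.
have P2 : normc (poch y m) <= 2.
  rewrite -[poch y m](subrK 1); apply: (le_trans (le_normcD _ _)).
  rewrite normc1; have := half m; move: IHm; move: (2^-1 ^+ m) => z.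
  by nra.
have -> : poch y m.+1 - 1 = - (poch y m * y ^+ m.+1) + (poch y m - 1).
  by rewrite pochS mulrBr mulr1 addrAC [RHS]addrC.
apply: (le_trans (le_normcD _ _)); rewrite normcN normcM normcX.
have y4' : 0 <= normc y <= 4^-1 by rewrite y0.
have h1 := normX_quarter m y4'.
have h2 : normc (poch y m) * normc y ^+ m.+1 <= 2 * (2 * normc y * 2^-1 ^+ m.+1).
  by apply: ler_pM; rewrite ?normc_ge0 ?exprn_ge0.
apply: (le_trans (lerD h2 IHm)); rewrite exprS.
by move: (2^-1 ^+ m) => z; lra.
Qed.

Lemma eulerf0 k : (0 < k)%N -> eulerf (0 : R[i]) k = 1.
Proof.
move=> k0; have h : normc (0 : R[i]) <= 4^-1 by rewrite normc0 invr_ge0.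
have := eulerf_near0 h k0; rewrite normc0 mulr0 => h'.
have /eq0_normc /eqP : normc (eulerf (0 : R[i]) k - 1) = 0.
  by apply/eqP; rewrite eq_le h' normc_ge0.
by rewrite subr_eq0 => /eqP.
Qed.

(** Nonzero points tending to 0; the exponent starts at 1 so that every term lies within the radius
    1/4 of [eulerf_near0]. *)
Definition quarter_pow m : R[i] := ((4^-1 : R) ^+ m.+1)%:C%C.

Lemma normc_quarter_pow m : normc (quarter_pow m) = 4^-1 ^+ m.+1.
Proof.
by rewrite /quarter_pow /= expr0n addr0 sqrtr_sqr ger0_norm// exprn_ge0 ?invr_ge0.
Qed.

Lemma normc_quarter_pow_le m : normc (quarter_pow m) <= 4^-1.
Proof.
rewrite normc_quarter_pow exprS ler_piMr ?invr_ge0// exprn_ile1// ?invr_ge0//.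
by lra.
Qed.

Lemma quarter_pow_neq0 m : quarter_pow m != 0.
Proof.
apply/eqP => h; have := normc_quarter_pow m; rewrite h normc0 => /esym/eqP.
by rewrite expf_eq0 invr_eq0 pnatr_eq0.
Qed.

Lemma quarter_pow_cvg (c : R) : (fun m => c * normc (quarter_pow m)) @ \oo --> 0.
Proof.
rewrite [X in X @ _](_ : _ = (fun m => c * 4^-1 * 4^-1 ^+ m)); last first.
  by apply/funext => m; rewrite normc_quarter_pow exprS mulrA.
by apply: (@cvg_geometric R); rewrite ger0_norm ?invr_ge0//; lra.
Qed.

Lemma quarter_pow_tends : tends quarter_pow 0.
Proof.
apply: cvg_normc (quarter_pow_cvg 1) => m.
by rewrite sub0r normcN mul1r.
Qed.

Lemma eulerf_quarter_pow k : (0 < k)%N ->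
  tends (fun m => eulerf (quarter_pow m) k) (eulerf 0 k).
Proof.
move=> k0; rewrite (eulerf0 k0).
apply: cvg_normc (quarter_pow_cvg 4) => m.
by rewrite -normcN opprB; apply: eulerf_near0 => //; exact: normc_quarter_pow_le.
Qed.

(* The value at [q = 0] is recovered from small nonzero arguments by
   continuity, the division by [q] in the trisection being illegal there. *)
Lemma has_sum_origin (a : nat -> R[i]) (V : R[i] -> R[i]) :
  (forall q, q != 0 -> `|q| < 1 -> has_sum (fun n => a n * q ^+ n) (V q)) ->
  tends (fun m => V (quarter_pow m)) (V 0) ->
  has_sum (fun n => a n * 0 ^+ n) (V 0).
Proof.
move=> hV V0; have lt1 (y : R[i]) : normc y < 1 -> `|y| < 1.
  by move=> h; rewrite norm_normc -[1]/(1%:C%C) ltcR.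
(* Convergence at 1/2 limits the growth of a_n to 2^n, which powers of a point of modulus at most
   1/4 outweigh. *)
pose h : R[i] := (2^-1 : R)%:C%C.
have nh : normc h = 2^-1.
  by rewrite /h /= expr0n addr0 sqrtr_sqr ger0_norm// invr_ge0.
have h0 : h != 0.
  apply/eqP => e; have := nh; rewrite e normc0 => /esym/eqP.
  by rewrite invr_eq0 pnatr_eq0.
have h1 : `|h| < 1 by apply: lt1; rewrite nh; lra.
have [B B0 hB] := tends_bounded (hV h h0 h1).
have aB n : normc (a n) * 2^-1 ^+ n <= 2 * B.
  have -> : normc (a n) * 2^-1 ^+ n = normc (a n * h ^+ n).
    by rewrite normcM normcX nh.
  have -> : a n * h ^+ n =
      series (fun k => a k * h ^+ k) n.+1 + - series (fun k => a k * h ^+ k) n.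
    by rewrite /series /= big_nat_recr//= addrAC subrr add0r.
  apply: (le_trans (le_normcD _ _)); rewrite normcN.
  by have := hB n.+1; have := hB n; lra.
(* At y = [quarter_pow m] the first partial sum is a_0, and the remaining increments add up to at
   most 8 B |y|. *)
have a0V : tends (fun m => V (quarter_pow m)) (a 0%N).
  apply: cvg_normc (quarter_pow_cvg (8 * B)) => m.
  rewrite -normcN opprB; set y := quarter_pow m.
  have y4 : normc y <= 4^-1 := normc_quarter_pow_le m.
  have y0 := normc_ge0 y.
  have y1 : `|y| < 1 by apply: lt1; lra.
  have hy := hV y (quarter_pow_neq0 m) y1.
  have hs := tends_subseq 1 (ltn0Sn 0) hy.
  apply: tends_normc_le hs _ => n; rewrite mul1n addn1.
  have E k : series (fun i => a i * y ^+ i) k.+2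
      - series (fun i => a i * y ^+ i) k.+1 = a k.+1 * y ^+ k.+1.
    by rewrite /series /= big_nat_recr//= addrAC subrr add0r.
  have c0 : 0 <= 8 * B * normc y by rewrite !mulr_ge0.
  have incr k : normc (series (fun i => a i * y ^+ i) k.+2
      - series (fun i => a i * y ^+ i) k.+1) <= 8 * B * normc y * 2^-1 ^+ k.+1.
    rewrite E normcM normcX.
    (* One copy of 2^-(k+1) offsets the growth of a_(k+1) by [aB], the other remains for
       [geometric_increments]; the constant 8 B is 4 times the 2 B of [aB]. *)
    have yk : normc y ^+ k.+1 <= 4 * normc y * (2^-1 ^+ k.+1 * 2^-1 ^+ k.+1).
      have -> : 2^-1 ^+ k.+1 * 2^-1 ^+ k.+1 = 4^-1 ^+ k.+1 :> R.
        by rewrite -exprMn; congr (_ ^+ _); lra.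
      rewrite 2!exprS.
      have : normc y ^+ k <= 4^-1 ^+ k by rewrite lerXn2r ?nnegrE ?invr_ge0.
      by move=> /(ler_wpM2l y0); lra.
    apply: (le_trans (ler_wpM2l (normc_ge0 _) yk)).
    have half : 0 <= 2^-1 ^+ k.+1 :> R by rewrite exprn_ge0// invr_ge0.
    have := ler_wpM2r (mulr_ge0 y0 half) (aB k.+1).
    move: (normc (a k.+1)) (2^-1 ^+ k.+1) {half} => A z.
    by lra.
  have := geometric_increments
    (u := fun k => series (fun i => a i * y ^+ i) k.+1) c0 incr n.
  rewrite {2}/series /= big_nat1 expr0 mulr1 => hn; apply: (le_trans hn).
  by rewrite ler_piMr// gerBl exprn_ge0// invr_ge0.
rewrite (tends_unique V0 a0V).
(* Since 0^0 = 1, every nonempty partial sum at 0 equals a_0; the shift skips the empty one. *)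
have : tends (fun n => series (fun k => a k * 0 ^+ k) n.+1) (a 0%N).
  apply: tends_eq (@tends_cst R[i] (a 0%N)) => n.
  rewrite /series /= big_nat_recl//= expr0 mulr1 big1 ?addr0// => k _.
  by rewrite expr0n mulr0.
by rewrite /tends cvg_shiftS.
Qed.

Lemma exists_cube_root_of_unity : exists w : R[i], 1 + w + w ^+ 2 = 0.
Proof.
have s3 : Num.sqrt (3 : R) ^+ 2 = 3 by rewrite sqr_sqrtr.
exists (- 2^-1 +i* (Num.sqrt 3 / 2))%C.
apply/eqP; rewrite expr2 eq_complex /=; apply/andP; split; apply/eqP.
  move: s3; move: (Num.sqrt 3) => s s3.
  have -> : s / 2 * (s / 2) = s ^+ 2 / 4 by field.
  by rewrite s3; field.
by move: (Num.sqrt 3) => s; field.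
Qed.

Lemma exists_cube_root q : `|q| < 1 -> exists2 x, `|x| < 1 & x ^+ 3 = q.
Proof.
move=> q1; have xq : (3.-root q) ^+ 3 = q by rewrite rootCK.
exists (3.-root q) => //.
by rewrite -(@expr_lt1 _ 3)// -normrX xq.
Qed.

End Origin.

(** * The three dissected generating functions *)

Lemma schur_series_trisect (R : realType) (l : nat) (Sbar : nat -> nat) (q : R[i]) :
  (0 < l)%N -> schur_overpartitions R (3 * l) Sbar -> q != 0 -> `|q| < 1 ->
  [/\ has_sum (fun n => (Sbar (3 * n)%N)%:R * q ^+ n)
        (schur_part0 (eulerf q) l q),
      has_sum (fun n => (Sbar (3 * n + 1)%N)%:R * q ^+ n)
        (schur_part1 (eulerf q) l q)
    & has_sum (fun n => (Sbar (3 * n + 2)%N)%:R * q ^+ n)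
        (schur_part2 (eulerf q) l q)].
Proof.
move=> l0 hS q0 q1; have [x x1 xq] := exists_cube_root q1.
have [w w1] := exists_cube_root_of_unity R.
have x0 : x != 0 by apply: contraNneq q0 => x0; rewrite -xq x0 expr0n.
apply: (tends_trisect x0 w1) => z zx.
have zq : z ^+ 3 = q by rewrite zx.
have z1 : `|z| < 1 by rewrite -(@expr_lt1 _ 3)// -normrX zq.
(* Only partial sums whose length is a multiple of 3 are kept, where the splitting is exact. *)
have hz := tends_subseq 0 (ltn0Sn 2) (hS z z1).
rewrite (schur_trisect z1 l0 w1) zq in hz.
apply: tends_eq hz => n; rewrite addn0.
exact: (@series_trisect R[i] (fun k => (Sbar k)%:R) z q n zq).
Qed.


(* The source prints an extra factor f 4 in the numerator of the very first
   term; with it the first identity fails at q ^ 4, for every l. *)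
Theorem theorem1p2 (R : realType) (l : nat) (Sbar : nat -> nat)
    (l_odd : odd l) (hS : schur_overpartitions R (3 * l)%N Sbar)
    (q : R[i]) (hq : `|q| < 1) :
  let f := eulerf q in
  [/\ has_sum (fun n => (Sbar (3 * n)%N)%:R * q ^+ n)
        ((f 2%N ^+ 4 * f 3%N ^+ 6 * f l ^+ 2 * f (4 * l)%N)
           / (f 1%N ^+ 8 * f 6%N * f 12%N * f (2 * l)%N ^+ 3)
         - 4 * q * ((f 2%N ^+ 4 * f 3%N ^+ 3 * f 12%N ^+ 2 * f l ^+ 2 * f (4 * l)%N)
           / (f 1%N ^+ 7 * f 4%N * f 6%N * f (2 * l)%N ^+ 3))),
      has_sum (fun n => (Sbar (3 * n + 1)%N)%:R * q ^+ n)
        (2 * ((f 2%N ^+ 3 * f 3%N ^+ 3 * f 6%N ^+ 2 * f l ^+ 2 * f (4 * l)%N)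
           / (f 1%N ^+ 7 * f (2 * l)%N ^+ 3 * f 12%N))
         - 8 * q * ((f 2%N ^+ 3 * f 6%N ^+ 2 * f 12%N ^+ 2 * f l ^+ 2 * f (4 * l)%N)
           / (f 1%N ^+ 6 * f 4%N * f (2 * l)%N ^+ 3)))
    & has_sum (fun n => (Sbar (3 * n + 2)%N)%:R * q ^+ n)
        (4 * ((f 2%N ^+ 2 * f 6%N ^+ 5 * f l ^+ 2 * f (4 * l)%N)
           / (f 1%N ^+ 6 * f (2 * l)%N ^+ 3 * f 12%N))
         - 2 * ((f 2%N ^+ 5 * f 3%N ^+ 6 * f 12%N ^+ 2 * f l ^+ 2 * f (4 * l)%N)
           / (f 1%N ^+ 8 * f 6%N ^+ 4 * f 4%N * f (2 * l)%N ^+ 3)))].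
Proof.
lazy zeta; have l0 : (0 < l)%N by case: l l_odd {hS}.
suff [] : [/\ has_sum (fun n => (Sbar (3 * n)%N)%:R * q ^+ n)
                (schur_part0 (eulerf q) l q),
              has_sum (fun n => (Sbar (3 * n + 1)%N)%:R * q ^+ n)
                (schur_part1 (eulerf q) l q)
            & has_sum (fun n => (Sbar (3 * n + 2)%N)%:R * q ^+ n)
                (schur_part2 (eulerf q) l q)].
  by rewrite /schur_part0 /schur_part1 /schur_part2 => h0 h1 h2; split;
    [exact: h0 | exact: h1 | exact: h2].
have [q0|q0] := eqVneq q 0; last exact: schur_series_trisect l0 hS q0 hq.
have e0 k : (0 < k)%N -> eulerf (0 : R[i]) k != 0.
  by move=> k0; rewrite eulerf0// oner_neq0.
have parts z z0 z1 := @schur_series_trisect R l Sbar z l0 hS z0 z1.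
have hy := @quarter_pow_tends R; have he := @eulerf_quarter_pow R.
rewrite q0; split.
- apply: (has_sum_origin (V := fun z => schur_part0 (eulerf z) l z)).
    by move=> z z0 z1; case: (parts z z0 z1).
  exact: schur_part0_tends l0 hy he e0.
- apply: (has_sum_origin (V := fun z => schur_part1 (eulerf z) l z)).
    by move=> z z0 z1; case: (parts z z0 z1).
  exact: schur_part1_tends l0 hy he e0.
- apply: (has_sum_origin (V := fun z => schur_part2 (eulerf z) l z)).
    by move=> z z0 z1; case: (parts z z0 z1).
  exact: schur_part2_tends l0 he e0.
Qed.
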